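(* Let $k$ be an algebraically closed field of characteristic $p>0$ and let $G$ be a finite $k$-group scheme. If $G$ is trigonalizable, then the classifying space $BG$ is retract rational over $k$.
   Context: Trigonalizable: an affine group scheme $G$ of finite type over a field $k$ is trigonalizable if it has a normal unipotent subgroup scheme $G_{\rm uni}$ such that $G/G_{\rm uni}$ is diagonalizable. Classifying space: for a finite $k$-group scheme $G$, a finite dimensional $k$-linear representation $\rho\colon G\to \mathrm{GL}_V$ is generically free if there is a $G$-stable Zariski dense open subset $U\subset V$ on which $G$ acts freely, i.e. $U\times G\to U\times U$, $(u,g)\mapsto (u,ug)$, is a monomorphism. One may take $U$ affine; then $U/G:=\operatorname{Spec} H^0(U,\mathcal{O}_U)^G$ is a geometric quotient and $U\to U/G$ is a $G$-torsor. Put $BG:=U/G$, a smooth connected $k$-scheme; its stable birational equivalence class does not depend on the choices of $\rho$ and $U$. Retract rational: a smooth connected $k$-scheme $X$ is retract rational over $k$ if there is a dominant rational map $f\colon \mathbb{A}^n_k\dashrightarrow X$ for some $n$ which admits a section $g\colon W\to\mathbb{A}^n_k$ (so $f\circ g$ is the inclusion of $W$ into $X$) defined over some dense open subset $W\subset X$. This depends only on the stable birational equivalence class of $X$, so for $BG$ it does not depend on the choices made. *)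

(* Defs.v *)
From HB Require Import structures.
From mathcomp Require Import all_boot all_algebra.
From mathcomp Require Import mpoly.
From Stdlib Require Import FunctionalExtensionality ProofIrrelevance.

Set Implicit Arguments.
Unset Strict Implicit.
Unset Printing Implicit Defensive.

Import GRing.Theory.
Local Open Scope ring_scope.

(* Conventions.  Every scheme below is affine over k, and the scheme Spec X is
   represented by its coordinate ring [X : comAlgType k].  A morphism
   Spec Y -> Spec X is a k-algebra morphism [f : {lrmorphism X -> Y}], which acts
   on points by precomposition.  An R-point of Spec X is a morphism
   Spec R -> Spec X.  Algebras in [comAlgType k] are nonzero; nothing is lost in
   testing on nonzero R only, since every scheme has exactly one point over the
   zero ring. *)
Notation points X R := {lrmorphism X -> R} (only parsing).

Lemma points_ext (k : fieldType) (X R : comAlgType k) (x y : points X R) :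
  x =1 y -> x = y.
Proof.
case: x y => [f [[fD] [fM] [fZ]]] [g [[gD] [gM] [gZ]]] /= efg.
have {}efg : f = g by apply: functional_extensionality.
case: g / efg gD gM gZ => gD gM gZ.
by rewrite (proof_irrelevance _ fD gD) (proof_irrelevance _ fM gM)
  (proof_irrelevance _ fZ gZ).
Qed.

Section Schemes.
Variable k : fieldType.

Definition affine_space (n : nat) : comAlgType k := {mpoly k[n]}.

Definition coords (n : nat) (R : comAlgType k) (v : points (affine_space n) R) :
  'rV[R]_n := \row_i v 'X_i.

Definition unit_ideal (R : comAlgType k) (S : R -> Prop) : Prop :=
  exists (d : nat) (s r : 'I_d -> R),
    (forall i, S (s i)) /\ \sum_i r i * s i = 1.

(* Spec U is, through j, the open subscheme Spec X \ V(S): an R-point x of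
   Spec X factors through the complement of V(S) iff x(S) generates R. *)
Definition affine_open (X U : comAlgType k) (j : {lrmorphism X -> U}) : Prop :=
  exists S : X -> Prop, forall R : comAlgType k,
    (forall y z : points U R, y \o j =1 z \o j -> y = z) /\
    (forall x : points X R,
       (exists y : points U R, y \o j =1 x) <->
       unit_ideal (fun r => exists2 s, S s & x s = r)).

(* Topological density of the image of Spec Y -> Spec X: the preimage D(f c) of
   a basic open D(c) is empty only if D(c) is, and D(c) is empty iff c is
   nilpotent. *)
Definition dominant (X Y : comAlgType k) (f : {lrmorphism X -> Y}) : Prop :=
  forall c : X, (exists e : nat, f c ^+ e = 0) -> exists e : nat, c ^+ e = 0.

Definition dense_affine_open (X U : comAlgType k) (j : {lrmorphism X -> U}) :
  Prop := affine_open j /\ dominant j.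

(* The rational map A^m --> Spec X is represented by a morphism f defined on a
   dense affine open D of A^m; its section g is defined on a dense affine open W
   of Spec X and takes values in D, so that f o g : W -> Spec X makes sense. *)
Definition retract_rational (X : comAlgType k) : Prop :=
  exists (m : nat) (D : comAlgType k) (j : {lrmorphism affine_space m -> D})
         (f : {lrmorphism X -> D}),
    [/\ dense_affine_open j, dominant f
      & exists (W : comAlgType k) (w : {lrmorphism X -> W})
               (g : {lrmorphism D -> W}),
          dense_affine_open w /\ g \o f =1 w].

(* Affine k-group schemes, as representable functors from k-algebras to groups. *)
Record group_scheme := GroupScheme {
  coord_ring : comAlgType k;
  gmul : forall R : comAlgType k,
    points coord_ring R -> points coord_ring R -> points coord_ring R;
  gone : forall R : comAlgType k, points coord_ring R;
  ginv : forall R : comAlgType k, points coord_ring R -> points coord_ring R;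
  gmulA : forall (R : comAlgType k) (x y z : points coord_ring R),
    gmul x (gmul y z) = gmul (gmul x y) z;
  gmul1 : forall (R : comAlgType k) (x : points coord_ring R),
    gmul (gone R) x = x;
  gmulV : forall (R : comAlgType k) (x : points coord_ring R),
    gmul (ginv x) x = gone R;
  gmul_natural : forall (R S : comAlgType k) (f : {lrmorphism R -> S})
      (x y : points coord_ring R),
    gmul (f \o x : points coord_ring S) (f \o y : points coord_ring S)
      = (f \o gmul x y : points coord_ring S)
}.

Definition finite_group_scheme (G : group_scheme) : Prop :=
  exists (d : nat) (b : 'I_d -> coord_ring G), forall a : coord_ring G,
    exists c : 'I_d -> k, a = \sum_i c i *: b i.

Definition group_hom (H G : group_scheme)
    (i : {lrmorphism coord_ring G -> coord_ring H}) : Prop :=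
  forall (R : comAlgType k) (x y : points (coord_ring H) R),
    (gmul x y \o i : points (coord_ring G) R)
      = gmul (x \o i : points (coord_ring G) R)
             (y \o i : points (coord_ring G) R).

Definition closed_subgroup (H G : group_scheme)
    (i : {lrmorphism coord_ring G -> coord_ring H}) : Prop :=
  group_hom i /\ (forall b : coord_ring H, exists a : coord_ring G, i a = b).

Definition normal_subgroup (H G : group_scheme)
    (i : {lrmorphism coord_ring G -> coord_ring H}) : Prop :=
  closed_subgroup i /\
  forall (R : comAlgType k) (g : points (coord_ring G) R)
         (h : points (coord_ring H) R),
    exists h' : points (coord_ring H) R,
      (h' \o i : points (coord_ring G) R)
        = gmul (gmul g (h \o i : points (coord_ring G) R)) (ginv g).

(* O(G/H) is the ring of functions on G invariant under translation by H. *)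
Definition is_quotient (H G Q : group_scheme)
    (i : {lrmorphism coord_ring G -> coord_ring H})
    (q : {lrmorphism coord_ring Q -> coord_ring G}) : Prop :=
  [/\ group_hom q, injective q
    & forall a : coord_ring G, (exists c : coord_ring Q, q c = a) <->
        forall (R : comAlgType k) (g : points (coord_ring G) R)
               (h : points (coord_ring H) R),
          gmul g (h \o i : points (coord_ring G) R) a = g a].

(* A morphism from G to n x n matrices is a matrix rho over O(G), whose value at
   a point g is [map_mx g rho].  Matrices act on row vectors from the right, so
   that v |-> v *m rho(g) is a right action of G on A^n. *)
Definition is_representation (G : group_scheme) (n : nat)
    (rho : 'M[coord_ring G]_n) :
  Prop :=
  forall R : comAlgType k,
    map_mx (gone G R) rho = 1%:M /\
    forall g h : points (coord_ring G) R,
      map_mx (gmul g h) rho = map_mx g rho *m map_mx h rho.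

(* Every nonzero linear representation has a nonzero fixed vector. *)
Definition unipotent (G : group_scheme) : Prop :=
  forall (n : nat) (rho : 'M[coord_ring G]_n),
    (0 < n)%N -> is_representation rho ->
    exists2 v : 'rV[k]_n, v != 0 &
      forall (R : comAlgType k) (g : points (coord_ring G) R),
        map_mx (in_alg R) v *m map_mx g rho = map_mx (in_alg R) v.

Definition is_character (G : group_scheme) (chi : coord_ring G) : Prop :=
  forall R : comAlgType k,
    gone G R chi = 1 /\
    forall g h : points (coord_ring G) R, gmul g h chi = g chi * h chi.

(* O(G) is spanned as a k-vector space by the characters G -> G_m. *)
Definition diagonalizable_group_scheme (G : group_scheme) : Prop :=
  forall a : coord_ring G,
  exists (d : nat) (c : 'I_d -> k)
         (chi : 'I_d -> coord_ring G),
    (forall i, is_character (chi i)) /\ a = \sum_i c i *: chi i.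

Definition trigonalizable_group_scheme (G : group_scheme) : Prop :=
  exists (Guni Q : group_scheme)
         (i : {lrmorphism coord_ring G -> coord_ring Guni})
         (q : {lrmorphism coord_ring Q -> coord_ring G}),
    [/\ normal_subgroup i, unipotent Guni, is_quotient i q
      & diagonalizable_group_scheme Q].

Section Action.
Variables (G : group_scheme) (n : nat) (rho : 'M[coord_ring G]_n).
Variables (U : comAlgType k) (j : {lrmorphism affine_space n -> U}).

Definition vec (R : comAlgType k) (u : points U R) : 'rV[R]_n :=
  coords (u \o j : points (affine_space n) R).

Definition stable_open : Prop :=
  forall (R : comAlgType k) (u : points U R) (g : points (coord_ring G) R),
    exists u' : points U R, vec u' = vec u *m map_mx g rho.

(* (u, g) |-> (u, u g) is a monomorphism U x G -> U x U. *)
Definition free_action : Prop :=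
  forall (R : comAlgType k) (u u' : points U R) (g g' : points (coord_ring G) R),
    u = u' -> vec u *m map_mx g rho = vec u' *m map_mx g' rho ->
    (u, g) = (u', g').

Definition invariant_function (b : U) : Prop :=
  forall (R : comAlgType k) (u u' : points U R) (g : points (coord_ring G) R),
    vec u' = vec u *m map_mx g rho -> u' b = u b.

End Action.

(* Spec X is a model of BG: it is U/G = Spec O(U)^G for a representation rho of
   G on A^n and a G-stable dense affine open U of A^n on which G acts freely. *)
Definition classifying_space (G : group_scheme) (X : comAlgType k) : Prop :=
  exists (n : nat) (rho : 'M[coord_ring G]_n) (U : comAlgType k)
         (j : {lrmorphism affine_space n -> U}) (pi : {lrmorphism X -> U}),
    [/\ is_representation rho,
        dense_affine_open j,
        stable_open rho j /\ free_action rho j,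
        injective pi
      & forall b : U, (exists x : X, pi x = b) <-> invariant_function rho j b].

End Schemes.

(* Main.v *)
Require Import Defs.
From HB Require Import structures.
From mathcomp Require Import all_boot all_algebra.
From mathcomp Require Import mpoly ring.
From Stdlib Require Import ClassicalEpsilon.

(** Let rho be the representation of G on V = A^n, and U the open subset of V, that define
    BG = Spec O(U)^G.  The point is that V is triangular in a suitable basis, and that for
    triangular actions an argument of Miyata makes the ring of invariants k[V]^G a polynomial
    ring up to inverting one element.  So BG shares a nonempty affine open subset with an affine
    space, and this open subset serves as the source of both the map and its section.  As G need
    not be reduced, group elements are points over arbitrary algebras, and f in k[V] is invariant
    when f (v rho) = f (v) as polynomials in v over A = O(G).

    Triangularity ([eigenline]).  The normal unipotent subgroup fixes some v <> 0.  By normality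
    the coefficients of v rho are functions on the diagonalizable quotient, so that
    v rho = sum_i chi_i w_i with linearly independent characters chi_i.  Comparing
    v rho(g h) with v rho(g) rho(h) for the universal pair (g, h), which lives over A (x) A
    ([tensor_exists]), gives w_i rho = chi_i w_i.  With a nonzero w_i as first basis vector, G
    acts on k[V] = B[X], where B is the polynomial ring in the other coordinates, by an action
    on B and by X |-> chi X + beta.

    Miyata's argument ([miyata]).  Let th be an invariant of least positive degree in X.  Its
    leading coefficient c satisfies r(c) chi^deg = c, where r is the action on B, and chi has
    finite order ([character_finite_order]); so a power h of c is invariant.  Pseudo-division of
    an invariant f by th gives h^e f = q th + u, and uniqueness of such a division, also over
    A[V], makes q and u invariant.  By minimality u is in B, and induction on the degree shows
    that h^e' f is a polynomial in th over the invariants of B.  If there is no th, then all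
    invariants of B[X] lie in B.  Induction on dim V yields algebraically independent invariants
    that generate k[V]^G up to inverting one of their polynomials ([invariants_rational]).

    Passing from V to U.  Some D(s), s <> 0, lies in U, and s has a nonzero invariant multiple h
    ([invariant_multiple]): the product of the translates of s under the finitely many k-points
    of G is invariant up to nilpotents, which a power of Frobenius kills.  An element of O(U)^G
    then becomes an invariant polynomial after multiplication by a power of h
    ([open_domain_fraction], [poly_invariant_function]), so O(U)^G and k[V]^G agree up to
    inverting h. *)

Set Implicit Arguments.
Unset Strict Implicit.
Unset Printing Implicit Defensive.

Import GRing.Theory.
Local Open Scope ring_scope.

(** * Morphisms and quotients of algebras *)

(** Instances of the generic morphism laws in which f keeps its type on both sides, so that
    they can be chained in rewriting. *)
Section LrmorphismTheory.
Variables (k : fieldType) (X Y : comAlgType k) (f : {lrmorphism X -> Y}).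

Lemma lrmorph0 : f 0 = 0. Proof. exact: rmorph0. Qed.
Lemma lrmorph1 : f 1 = 1. Proof. exact: rmorph1. Qed.
Lemma lrmorphD x y : f (x + y) = f x + f y. Proof. exact: rmorphD. Qed.
Lemma lrmorphB x y : f (x - y) = f x - f y. Proof. exact: rmorphB. Qed.
Lemma lrmorphM x y : f (x * y) = f x * f y. Proof. exact: rmorphM. Qed.
Lemma lrmorphX x e : f (x ^+ e) = f x ^+ e. Proof. exact: rmorphXn. Qed.
Lemma lrmorphZ a x : f (a *: x) = a *: f x. Proof. exact: linearZ. Qed.
Lemma lrmorph_alg a : f a%:A = a%:A. Proof. by rewrite lrmorphZ lrmorph1. Qed.
Lemma lrmorph_sum (I : Type) (r : seq I) (P : pred I) (F : I -> X) :
  f (\sum_(i <- r | P i) F i) = \sum_(i <- r | P i) f (F i).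
Proof. exact: rmorph_sum. Qed.

End LrmorphismTheory.

Section MakeMorphism.
Variables (k : fieldType) (X Y : comAlgType k) (f : X -> Y).
Hypothesis f_lin : linear f.
Hypothesis f_one : f 1 = 1.
Hypothesis f_mul : {morph f : x y / x * y}.

Let g := f.
HB.instance Definition _ := GRing.isLinear.Build k X Y _ g f_lin.
HB.instance Definition _ := GRing.isMonoidMorphism.Build X Y g (conj f_one f_mul).

Lemma make_lrmorphism : exists h : {lrmorphism X -> Y}, h =1 f.
Proof. by exists (g : {lrmorphism X -> Y}). Qed.

End MakeMorphism.

(** Many morphisms below send x to the image of some lift of x.  Additivity reduces the
    independence of the lift to the case x = 0. *)
Lemma graph_lrmorphism (k : fieldType) (X Y : comAlgType k) (E : X -> Y -> Prop) :
  (forall x, exists y, E x y) ->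
  (forall y, E 0 y -> y = 0) ->
  (forall a x x' y y', E x y -> E x' y' -> E (a *: x + x') (a *: y + y')) ->
  (forall x x' y y', E x y -> E x' y' -> E (x * x') (y * y')) ->
  E 1 1 ->
  exists h : {lrmorphism X -> Y}, forall x, E x (h x).
Proof.
move=> Etot E0 Elin EM E1.
have Efun x y y' : E x y -> E x y' -> y = y'.
  move=> Exy Exy'; apply/eqP; rewrite -subr_eq0; apply/eqP/E0.
  by have := Elin (-1) _ _ _ _ Exy' Exy; rewrite !scaleN1r addNr addrC.
pose f x := sval (constructive_indefinite_description _ (Etot x)).
have Ef x : E x (f x) by exact: svalP (constructive_indefinite_description _ (Etot x)).
have [] := @make_lrmorphism k X Y f.
- by move=> a x y; apply: Efun (Ef _) _; exact: Elin.
- exact: Efun (Ef _) _.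
- by move=> x y; apply: Efun (Ef _) _; exact: EM.
by move=> h hf; exists h => x; rewrite hf.
Qed.

Definition is_ideal (R : nzRingType) (I : R -> Prop) : Prop :=
  [/\ I 0, forall x y, I x -> I y -> I (x + y) & forall a x, I x -> I (a * x)].

Section Quotient.
Variables (k : fieldType) (R : comNzRingType) (c : {rmorphism k -> R}).
Variable (I : R -> Prop).
Hypotheses (I_ideal : is_ideal I) (I1 : ~ I 1).

Let mem : pred R :=
  fun x => if excluded_middle_informative (I x) then true else false.
Let memP x : reflect (I x) (x \in mem).
Proof.
by rewrite /in_mem /= /mem; case: excluded_middle_informative => ?; constructor.
Qed.

Let mem_idealr : idealr_closed mem.
Proof.
case: I_ideal => I0 ID IM; split; [exact/memP|by apply/memP|].
by move=> a x y /memP Ix /memP Iy; apply/memP/ID/Iy/IM.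
Qed.
HB.instance Definition _ := isIdealr.Build R mem mem_idealr.

Let Q : Type := {ideal_quot (mem : idealr R)}.
HB.instance Definition _ := GRing.ComNzRing.on Q.
Local Open Scope quotient_scope.
Let pr (x : R) : Q := \pi_({ideal_quot (mem : idealr R)}) x.

Let prD : {morph pr : x y / x + y}. Proof. exact: rmorphD. Qed.
Let prM : {morph pr : x y / x * y}. Proof. exact: rmorphM. Qed.
Let pr1 : pr 1 = 1. Proof. exact: rmorph1. Qed.

Let scale (a : k) (z : Q) : Q := pr (c a) * z.
Let scaleA a b z : scale a (scale b z) = scale (a * b) z.
Proof. by rewrite /scale rmorphM /= prM mulrA. Qed.
Let scale1 : left_id 1 scale.
Proof. by move=> z; rewrite /scale rmorph1 /= pr1 mul1r. Qed.
Let scaleDr : right_distributive scale +%R.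
Proof. by move=> a x y; rewrite /scale mulrDr. Qed.
Let scaleDl z : {morph scale^~ z : a b / a + b}.
Proof. by move=> a b; rewrite /scale rmorphD /= prD mulrDl. Qed.
HB.instance Definition _ :=
  GRing.Zmodule_isLmodule.Build k Q scaleA scale1 scaleDr scaleDl.
Let scaleAl (a : k) (x y : Q) : a *: (x * y) = a *: x * y.
Proof. exact: mulrA. Qed.
HB.instance Definition _ := GRing.Lmodule_isLalgebra.Build k Q scaleAl.
HB.instance Definition _ := GRing.Lalgebra_isComAlgebra.Build k Q.

Let prm : {rmorphism R -> Q} := \pi_({ideal_quot (mem : idealr R)}).

(** The scalars of R are given by a morphism c, because R will be a polynomial ring over a
    k-algebra A, whose algebra structure is over A. *)
Lemma quotient_exists : exists (Q' : comAlgType k) (q : {rmorphism R -> Q'}),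
  [/\ forall a, q (c a) = a%:A, forall z, exists x, q x = z
    & forall x, q x = 0 <-> I x].
Proof.
exists (Q : comAlgType k), prm; split.
- by move=> a; rewrite -[LHS]mulr1.
- by move=> z; exists (repr z); rewrite /prm /= reprK.
move=> x; split=> [|Ix].
  move=> e; have: x == 0 %[mod {ideal_quot (mem : idealr R)}].
    by apply/eqP; rewrite [LHS]e; apply/esym; rewrite -[LHS]/(prm 0) rmorph0.
  by rewrite -Quotient.idealrBE subr0 => /memP.
have: x == 0 %[mod {ideal_quot (mem : idealr R)}].
  by rewrite -Quotient.idealrBE subr0; apply/memP.
by move/eqP => e; rewrite [LHS]e -[LHS]/(prm 0) rmorph0.
Qed.

End Quotient.

(** * Localization at one element *)

(** A property of c instead of a construction, because one algebra will be recognized as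
    a localization of two different ones. *)
Definition is_localization (k : fieldType) (A L : comAlgType k)
    (c : {lrmorphism A -> L}) (s : A) : Prop :=
  [/\ exists r, r * c s = 1,
      forall a, c a = 0 -> exists e, s ^+ e * a = 0
    & forall z, exists e a, c s ^+ e * z = c a].

(** A[1/s] is A[X] / (s X - 1).  If a constant b equals (s X - 1) G, then the
    coefficients of G are - s^i b, and only finitely many of them are nonzero. *)
Lemma localization_exists (k : fieldType) (A : comAlgType k) (s : A) :
  (forall e, s ^+ e != 0) ->
  exists (L : comAlgType k) (c : {lrmorphism A -> L}), is_localization c s.
Proof.
move=> s_nnil.
pose I (F : {poly A}) := exists G, F = (s *: 'X - 1) * G.
have kerI b : I b%:P -> exists e, s ^+ e * b = 0.
  case=> G eG; exists (size G).
  suff cG i : G`_i = - (s ^+ i * b).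
    by apply/eqP; rewrite -oppr_eq0 -cG nth_default.
  elim: i => [|i IHi].
    have := congr1 (fun F : {poly A} => F`_0) eG.
    rewrite /= coefC eqxx mulrBl mul1r coefB -scalerAl coefZ coefXM /=.
    by rewrite mulr0 sub0r expr0 mul1r => ->; rewrite opprK.
  have := congr1 (fun F : {poly A} => F`_i.+1) eG.
  rewrite /= coefC /= mulrBl mul1r coefB -scalerAl coefZ coefXM /= IHi.
  by move/esym/eqP; rewrite subr_eq0 => /eqP <-; rewrite mulrN mulrA exprS.
have [||Q [q [qc qsurj qker]]] :=
    @quotient_exists k {poly A} (polyC \o in_alg A : {rmorphism k -> {poly A}}) I.
- split; first by exists 0; rewrite mulr0.
    by move=> _ _ [G ->] [H ->]; exists (G + H); rewrite mulrDr.
  by move=> a _ [G ->]; exists (a * G); rewrite mulrCA.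
- by case/(kerI 1) => e; rewrite mulr1 => /eqP; apply/negP.
have [|||c ec] := @make_lrmorphism k A Q (q \o polyC).
- move=> a x y /=; rewrite polyCD rmorphD /=; congr (_ + _).
  by rewrite -[a *: x]mulr_algl polyCM rmorphM /= (qc a) mulr_algl.
- by rewrite /= rmorph1.
- by move=> x y; rewrite /= polyCM rmorphM.
have ecE a : c a = q a%:P by rewrite ec.
have sX : c s * q 'X = 1.
  apply/eqP; rewrite -subr_eq0 ecE -rmorphM -(rmorph1 q) -rmorphB.
  by apply/eqP/qker; exists 1; rewrite mulr1 mul_polyC.
exists Q, c; split.
- by exists (q 'X); rewrite mulrC.
- by move=> a; rewrite ecE => /qker/kerI.
move=> z; have [F <-] := qsurj z.
elim/poly_ind: F => [|F b [e [a eF]]].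
  by exists 0%N, 0; rewrite !rmorph0 mulr0.
exists e.+1, (a + s ^+ e.+1 * b).
rewrite [q _]rmorphD [q (_ * _)]rmorphM mulrDr -ecE lrmorphD lrmorphM lrmorphX.
congr (_ + _).
by rewrite exprSr mulrACA sX mulr1 eF.
Qed.

Section LocalizationTheory.
Variables (k : fieldType) (A L B : comAlgType k).
Variables (c : {lrmorphism A -> L}) (s : A).
Hypothesis cs : is_localization c s.

(** The lift sends a / s^e to f a / f s^e. *)
Lemma localization_lift (f : {lrmorphism A -> B}) :
  (exists r, r * f s = 1) -> exists g : {lrmorphism L -> B}, g \o c =1 f.
Proof.
case: cs => [[rL erL] cker csurj] [r er].
have regP e (w : B) : f s ^+ e * w = 0 -> w = 0.
  move=> ew; rewrite -[w]mul1r -(expr1n _ e) -er exprMn -mulrA ew.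
  by rewrite mulr0.
pose E (z : L) (w : B) := exists e a, c s ^+ e * z = c a /\ f s ^+ e * w = f a.
have [|||||g gE] := @graph_lrmorphism k L B E.
- move=> z; have [e [a ea]] := csurj z.
  exists (r ^+ e * f a), e, a; split=> //.
  by rewrite mulrA -exprMn [f s * r]mulrC er expr1n mul1r.
- move=> y [e [a [e1 e2]]].
  have [e' ea] : exists e', s ^+ e' * a = 0 by apply: cker; rewrite -e1 mulr0.
  apply: (regP (e' + e)%N); rewrite exprD -mulrA e2 -lrmorphX -lrmorphM.
  by rewrite ea rmorph0.
- move=> x z z' w w' [e [a [e1 e2]]] [e' [a' [e1' e2']]].
  exists (e + e')%N, (x *: (s ^+ e' * a) + s ^+ e * a').
  rewrite !(lrmorphD, lrmorphZ, lrmorphM, lrmorphX) -e1 -e2 -e1' -e2'.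
  by split; rewrite mulrDr -!scalerAr exprD; congr (x *: _ + _);
    rewrite ?mulrA // [X in X * _ = _]mulrC.
- move=> z z' w w' [e [a [e1 e2]]] [e' [a' [e1' e2']]].
  exists (e + e')%N, (a * a').
  by rewrite !lrmorphM -e1 -e2 -e1' -e2' !exprD; split; rewrite mulrACA.
- by exists 0%N, 1; rewrite !rmorph1 !mulr1 !expr0.
exists g => a /=; have [e [b [e1 e2]]] := gE (c a).
have [e' ea] : exists e', s ^+ e' * (s ^+ e * a - b) = 0.
  by apply: cker; rewrite lrmorphB lrmorphM lrmorphX /= e1 subrr.
apply/eqP; rewrite -subr_eq0; apply/eqP/(regP (e' + e)%N).
have: f (s ^+ e' * (s ^+ e * a - b)) = 0 by rewrite ea rmorph0.
rewrite !(lrmorphM, lrmorphB, lrmorphX) => h.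
by rewrite exprD -mulrA mulrBr e2 -opprB mulrN h oppr0.
Qed.

Lemma localization_ext (f g : {lrmorphism L -> B}) : f \o c =1 g \o c -> f =1 g.
Proof.
case: cs => [[rL erL] cker csurj] fg z; have [e [a ea]] := csurj z.
have: f (rL ^+ e * (c s ^+ e * z)) = g (rL ^+ e * (c s ^+ e * z)).
  rewrite ea !lrmorphM !lrmorphX -[f (c a)]/((f \o c) a) fg /=.
  congr (_ ^+ _ * _).
  have inv (h : {lrmorphism L -> B}) : h rL * h (c s) = 1.
    by rewrite -lrmorphM erL rmorph1.
  rewrite -[LHS]mulr1 -(inv g) mulrCA -[g (c s)]/((g \o c) s) -fg.
  by rewrite inv mulr1.
by rewrite mulrA -exprMn erL expr1n mul1r.
Qed.

End LocalizationTheory.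

Lemma unit_idealP1 (k : fieldType) (R : comAlgType k) (S : R -> Prop) (s r : R) :
  S s -> r * s = 1 -> unit_ideal S.
Proof.
move=> Ss rs; exists 1%N, (fun=> s), (fun=> r).
by split=> // ; rewrite big_ord1.
Qed.

(** A point of Spec A lies in D(s) iff it makes s invertible. *)
Lemma localization_affine_open (k : fieldType) (A L : comAlgType k)
    (c : {lrmorphism A -> L}) (s : A) :
  is_localization c s -> affine_open c.
Proof.
move=> cs; exists (fun a => a = s) => R; split=> [y z|x].
  by move=> eyz; apply/points_ext/(localization_ext cs).
split=> [[y yx]|[d [t [r [St e1]]]]].
  have [[r er] _ _] := cs.
  apply: (@unit_idealP1 _ _ _ (x s) (y r)); first by exists s.
  by rewrite -yx /= -lrmorphM er rmorph1.
apply: (localization_lift cs); exists (\sum_i r i).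
rewrite -e1 mulr_suml; apply: eq_bigr => i _.
by have [_ -> <-] := St i.
Qed.

Lemma localization_dense_affine_open (k : fieldType) (A L : comAlgType k)
    (c : {lrmorphism A -> L}) (s : A) :
  is_localization c s -> (forall a, s * a = 0 -> a = 0) ->
  dense_affine_open c.
Proof.
move=> cs sreg; split; first exact: localization_affine_open cs.
have [_ cker _] := cs.
move=> a [e]; rewrite -lrmorphX => /cker [e' ea]; exists e.
elim: e' ea => [|e' IHe]; first by rewrite mul1r.
by rewrite exprS -mulrA => /sreg.
Qed.

(** * Dense affine open subschemes of an integral scheme *)

(** The body of [affine_open] for a given S, whose elements the proofs below name. *)
Definition open_complement (k : fieldType) (X U : comAlgType k)
    (j : {lrmorphism X -> U}) (S : X -> Prop) : Prop :=
  forall R : comAlgType k,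
    (forall y z : points U R, y \o j =1 z \o j -> y = z) /\
    (forall x : points X R,
       (exists y : points U R, y \o j =1 x) <->
       unit_ideal (fun r => exists2 s, S s & x s = r)).

Section OpenComplement.
Variables (k : fieldType) (X U : comAlgType k) (j : {lrmorphism X -> U}).
Variable (S : X -> Prop).
Hypothesis jS : open_complement j S.

(** D(s) is contained in Spec U, so U has the same localization at s as X: the inclusion
    of D(s) gives U -> X[1/s], and U -> X[1/s] -> U[1/s] is the canonical map, since both
    agree on X and Spec U -> Spec X is a monomorphism. *)
Lemma open_fraction (s : X) : S s -> (forall e, s ^+ e != 0) ->
  (forall e, j s ^+ e != 0) ->
  forall b : U, exists e f, j s ^+ e * b = j f.
Proof.
move=> Ss s_nnil js_nnil b.
have [L [c cs]] := localization_exists s_nnil.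
have [M [d ds]] := localization_exists js_nnil.
have [y yj] : exists y : points U L, y \o j =1 c.
  have [_ ->] := jS L; have [[r er] _ _] := cs.
  by apply: (@unit_idealP1 _ _ _ (c s) r) => //; exists s.
have [g gc] : exists g : {lrmorphism L -> M}, g \o c =1 d \o j.
  by have [[r er] _ _] := ds; apply: (localization_lift cs); exists r.
(* Both morphisms extend the canonical map X -> M, and j is an epimorphism. *)
have gyd : (g \o y : points U M) = d.
  have [mono _] := jS M; apply: mono => x /=.
  by rewrite -[y (j x)]/((y \o j) x) yj -[LHS]/((g \o c) x) gc.
have [_ _ csurj] := cs; have [e [f ef]] := csurj (y b).
have [_ dker _] := ds.
have [e' e'0] : exists e', j s ^+ e' * (j s ^+ e * b - j f) = 0.
  apply: dker; rewrite !(lrmorphB, lrmorphM, lrmorphX) -gyd /=.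
  have yE x : y (j x) = c x by rewrite -yj.
  by rewrite !yE -ef lrmorphM lrmorphX subrr.
exists (e' + e)%N, (s ^+ e' * f).
apply/eqP; rewrite -subr_eq0 lrmorphM lrmorphX exprD -mulrA -mulrBr.
exact/eqP.
Qed.

(** Spec U avoids V(S): the identity of U is a point of Spec U. *)
Lemma open_unit_ideal :
  exists (d : nat) (s : 'I_d -> X) (r : 'I_d -> U),
    (forall i, S (s i)) /\ \sum_i r i * j (s i) = 1.
Proof.
have [_ /(_ j) [+ _]] := jS U; case.
  by exists [the {lrmorphism U -> U} of idfun].
move=> d [t [r [St e1]]].
pose s i := sval (constructive_indefinite_description _
  (let: ex_intro2 s Ss e := St i in ex_intro (fun s => S s /\ j s = t i) s (conj Ss e))).
have sP i : S (s i) /\ j (s i) = t i.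
  by rewrite /s; case: constructive_indefinite_description.
exists d, s, r; split=> [i|]; first by case: (sP i).
by rewrite -e1; apply: eq_bigr => i _; have [_ ->] := sP i.
Qed.

Hypothesis domX : forall a b : X, a * b = 0 -> a = 0 \/ b = 0.
Hypothesis j_inj : forall a : X, j a = 0 -> a = 0.

Let nnil (s : X) : s != 0 -> forall e, s ^+ e != 0.
Proof.
move=> s0; elim=> [|e IHe]; first by rewrite oner_eq0.
apply/eqP; rewrite exprS => /domX [] /eqP; first exact/negP.
exact/negP.
Qed.

Lemma open_domain_fraction (s : X) : S s -> s != 0 ->
  forall b : U, exists e f, j s ^+ e * b = j f.
Proof.
move=> Ss s0; apply: open_fraction => //; first exact: nnil.
move=> e; rewrite -lrmorphX; apply/eqP => /j_inj/eqP; apply/negP; exact: nnil.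
Qed.

Lemma open_nonempty : exists2 s, S s & s != 0.
Proof.
have [d [s [r [Ss e1]]]] := open_unit_ideal.
apply: NNPP => noS; have/eqP := oner_neq0 U; apply; rewrite -e1 big1 // => i _.
have -> : s i = 0.
  apply/eqP; apply: contraT => si0; case: noS; by exists (s i).
by rewrite lrmorph0 mulr0.
Qed.

(** On D(s) with s in S, the algebra U is a localization of the domain X, where a is
    regular; so b is killed by a power of every s in S, and S generates the unit ideal of U. *)
Lemma open_regular (a : X) (b : U) : a != 0 -> j a * b = 0 -> b = 0.
Proof.
move=> a0 ab; have [d [s [r [Ss e1]]]] := open_unit_ideal.
have nil i : exists e, j (s i) ^+ e * b = 0.
  have [->|si0] := eqVneq (s i) 0; first by exists 1%N; rewrite lrmorph0 mul0r.
  have [e [f ef]] := open_domain_fraction (Ss i) si0 b; exists e.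
  have : j (a * f) = 0 by rewrite lrmorphM -ef mulrCA ab mulr0.
  by case/j_inj/domX => [/eqP|f0]; [rewrite (negPf a0)|rewrite ef f0 lrmorph0].
apply: NNPP => b0.
(* Multiplying b by powers of the s i, each as high as possible without      *)
(* reaching 0, makes the s i themselves kill the product.                    *)
have [u ub0 kub] : exists2 u, u * b <> 0
    & forall i, i \in enum 'I_d -> j (s i) * (u * b) = 0.
  elim: (enum 'I_d) => [|i l [u ub0 kub]]; first by exists 1; rewrite ?mul1r.
  have nilu : exists e, j (s i) ^+ e * (u * b) == 0.
    by have [e e0] := nil i; exists e; rewrite mulrCA e0 mulr0.
  have := ex_minnP nilu; case=> [[|m]] /eqP eqm min_m.
    by case: ub0; rewrite -[LHS]mul1r.
  exists (j (s i) ^+ m * u); first by rewrite -mulrA => /eqP/min_m; rewrite ltnn.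
  move=> i'; rewrite -mulrA inE => /orP[/eqP->|/kub e0].
    by rewrite mulrA -exprS.
  by rewrite mulrCA e0 mulr0.
apply: ub0; rewrite -[LHS]mul1r -e1 mulr_suml big1 // => i _.
by rewrite -mulrA kub ?mulr0 ?mem_enum.
Qed.

End OpenComplement.

(** * Points of a finite algebra over an algebraically closed field *)

Lemma left_kernel_vector (k : fieldType) m d (M : 'M[k]_(m, d)) :
  (d < m)%N -> exists2 u : 'rV_m, u != 0 & u *m M = 0.
Proof.
move=> dm; exists (nz_row (kermx M)).
  rewrite nz_row_eq0 -mxrank_eq0 mxrank_ker subn_eq0 -ltnNge.
  exact: leq_ltn_trans (rank_leq_col M) dm.
by apply/sub_kermxP/nz_row_sub.
Qed.

Definition spans (k : fieldType) (A : comAlgType k) d (b : 'I_d -> A) :=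
  forall a : A, exists c : 'I_d -> k, a = \sum_i c i *: b i.

Section FiniteAlgebra.
Variables (k : closedFieldType) (A : comAlgType k) (d : nat) (b : 'I_d -> A).
Hypothesis b_spans : spans b.

(** The d + 1 elements 1, a, ..., a^d are linearly dependent, and the polynomial that
    expresses this splits over k. *)
Lemma split_annihilator (a : A) : exists rs : seq k,
  (size rs <= d)%N /\ \prod_(z <- rs) (a - z%:A) = 0.
Proof.
pose c (i : 'I_d.+1) := sval (constructive_indefinite_description _ (b_spans (a ^+ i))).
have cE (i : 'I_d.+1) : a ^+ i = \sum_j c i j *: b j.
  exact: svalP (constructive_indefinite_description _ (b_spans (a ^+ i))).
have [u u0 uM] := left_kernel_vector (\matrix_(i, j) c i j) (ltnSn d).
pose p : {poly k} := \poly_(i < d.+1) u 0 (inord i).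
have p0 : p != 0.
  apply: contraNneq u0 => p0; apply/eqP/rowP => i; rewrite mxE.
  by have := coef0 k i; rewrite -p0 coef_poly ltn_ord inord_val.
have pa : horner_alg a p = 0.
  rewrite /p poly_def raddf_sum /=.
  under eq_bigr => i _.
    rewrite linearZ_LR rmorphXn /= horner_algX inord_val.
    rewrite cE mulr_algl scaler_sumr. over.
  rewrite exchange_big big1 //= => j _.
  under eq_bigr => i _ do rewrite scalerA.
  rewrite -scaler_suml; have /rowP/(_ j) := uM; rewrite !mxE.
  by under eq_bigr => i _ do rewrite mxE; move=> ->; rewrite scale0r.
have [rs ers] := closed_field_poly_normal p; exists rs; split.
  have := size_poly d.+1 (fun i => u 0 (inord i)).
  by rewrite -/p ers size_scale ?lead_coef_eq0 // size_prod_XsubC ltnS.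
have lc : lead_coef p != 0 by rewrite lead_coef_eq0.
have : horner_alg a (\prod_(z <- rs) ('X - z%:P)) = 0.
  apply: (scalerI lc); rewrite scaler0 -pa [in RHS]ers.
  by rewrite linearZ_LR /= ?mulr_algl.
rewrite rmorph_prod /=; under eq_bigr => z _ do
  rewrite rmorphB /= horner_algC horner_algX.
by [].
Qed.

Definition adjoin_ideal (I : A -> Prop) (c : A) : A -> Prop :=
  fun x => exists y r, I y /\ x = y + r * c.

Lemma adjoin_is_ideal I c : is_ideal I -> is_ideal (adjoin_ideal I c).
Proof.
case=> I0 ID IM; split.
- by exists 0, 0; rewrite mul0r addr0.
- move=> _ _ [y [r [Iy ->]]] [y' [r' [Iy' ->]]].
  by exists (y + y'), (r + r'); split; [exact: ID|rewrite mulrDl addrACA].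
- move=> a _ [y [r [Iy ->]]]; exists (a * y), (a * r).
  by split; [exact: IM|rewrite mulrDr mulrA].
Qed.

Lemma adjoin_subset (I : A -> Prop) c x : I x -> adjoin_ideal I c x.
Proof. by exists x, 0; rewrite mul0r addr0. Qed.

(** Otherwise the ideals (I, a - z) are all the unit ideal, hence so is the ideal generated
    by I and a product of elements a - z that vanishes. *)
Lemma ideal_sub_scalar I a : is_ideal I -> ~ I 1 ->
  exists z : k, ~ adjoin_ideal I (a - z%:A) 1.
Proof.
move=> [I0 ID IM] I1; apply: NNPP => all1.
have {}all1 z : adjoin_ideal I (a - z%:A) 1.
  by apply: NNPP => h; apply: all1; exists z.
have [rs [_ rs0]] := split_annihilator a; case: I1.
suff [y [r [Iy ->]]] : adjoin_ideal I (\prod_(z <- rs) (a - z%:A)) 1.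
  by rewrite rs0 mulr0 addr0.
elim: rs {rs0} => [|z rs [y [r [Iy e1]]]].
  by exists 0, 1; rewrite big_nil mulr1 add0r.
have [y' [r' [Iy' e1']]] := all1 z.
exists (y * (y' + r' * (a - z%:A)) + r * \prod_(z <- rs) (a - z%:A) * y'), (r * r').
split.
  by apply: ID; [rewrite mulrC|]; apply: IM.
rewrite big_cons; set P := \prod_(_ <- _) _ in e1 *; set c := a - _ in e1' *.
have -> : (1 : A) = (y + r * P) * (y' + r' * c) by rewrite -e1 -e1' mulr1.
suff ringE (R : comNzRingType) (y0 r0 P0 y1 r1 c0 : R) : (y0 + r0 * P0) * (y1 + r1 * c0)
  = (y0 * (y1 + r1 * c0) + r0 * P0 * y1) + r0 * r1 * (c0 * P0) by exact: ringE.
by ring.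
Qed.

(** Enlarge I to a proper ideal that contains b_i - z_i for each i and some scalars z_i.
    The quotient by it is k. *)
Lemma ideal_point I : is_ideal I -> ~ I 1 ->
  exists g : points A k^o, forall x, I x -> g x = 0.
Proof.
move=> idI I1.
have [J [[J0 JD JM] J1 IJ bJ]] : exists J : A -> Prop,
    [/\ is_ideal J, ~ J 1, forall x, I x -> J x
      & forall i, i \in enum 'I_d -> exists z : k, J (b i - z%:A)].
  elim: (enum 'I_d) => [|i l [J [idJ J1 IJ bJ]]]; first by exists I.
  have [z Jz1] := ideal_sub_scalar (b i) idJ J1.
  exists (adjoin_ideal J (b i - z%:A)); split=> //.
  - exact: adjoin_is_ideal.
  - by move=> x /IJ; exact: adjoin_subset.
  move=> i'; rewrite inE => /orP[/eqP->|/bJ [z' Jz']]; last first.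
    by exists z'; exact: adjoin_subset.
  by exists z, 0, 1; case: idJ => J0 _ _; rewrite mul1r add0r.
pose E (a : A) (z : k^o) := J (a - z%:A).
have JZ (c : k) x : J x -> J (c *: x) by rewrite -mulr_algl; exact: JM.
have Elin c a a' z z' : E a z -> E a' z' -> E (c *: a + a') (c *: z + z').
  rewrite /E => Ez Ez'; have := JD _ _ (JZ c _ Ez) Ez'; congr J.
  by rewrite scalerBr scalerDl scalerA opprD addrACA.
have E0 : E 0 0 by rewrite /E scale0r subrr.
have [|||||g gE] := @graph_lrmorphism k A k^o E.
- move=> a; have [c ->] := b_spans a.
  elim/big_ind: _; first by exists 0.
    move=> x y [z Ez] [z' Ez']; exists (1 *: z + z').
    by rewrite -[x]scale1r; exact: Elin.
  move=> i _; have [z Jz] := bJ i (mem_enum _ i); exists (c i *: (z : k^o) + 0).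
  by rewrite -[X in E X]addr0; exact: Elin.
- move=> z Ez; apply/eqP/negP => /negP z0; apply: J1.
  have := JZ (- z^-1) _ Ez; congr J.
  by rewrite sub0r scalerN scaleNr opprK scalerA mulVf // scale1r.
- exact: Elin.
- move=> a a' z z' Ez Ez'; rewrite /E.
  have := JD _ _ (JM a' _ Ez) (JM z%:A _ Ez'); congr J.
  rewrite -scalerA -[z *: (z' *: 1)]mulr_algl; move: z%:A z'%:A => w w'.
  by rewrite !mulrBr addrA [w * a']mulrC subrK [a' * a]mulrC.
- by rewrite /E scale1r subrr.
exists g => x /IJ Jx; have := JD _ _ Jx (JM (-1) _ (gE x)).
rewrite mulN1r opprB addrC subrK -/(E 0 _) => Jg.
apply/eqP/negP => /negP gx0; apply: J1.
have := JZ (g x)^-1 _ Jg; congr J.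
by rewrite scalerA mulVf // scale1r.
Qed.

(** Write 0 as a product of at most d factors a - z.  Those with z <> 0 are invertible,
    as a point cannot send a to z; the others are equal to a.  That the exponent does not
    depend on a is essential for families of elements a. *)
Lemma nilpotent_of_points (a : A) :
  (forall g : points A k^o, g a = 0) -> a ^+ d = 0.
Proof.
move=> ga0.
have unit_sub (z : k) : z != 0 -> exists r, r * (a - z%:A) = 1.
  move=> z0; apply: NNPP => no.
  have [||g gz] := @ideal_point (fun x => exists r, x = r * (a - z%:A)).
  - split; first by exists 0; rewrite mul0r.
    + by move=> _ _ [r ->] [r' ->]; exists (r + r'); rewrite mulrDl.
    + by move=> c _ [r ->]; exists (c * r); rewrite mulrA.
  - by case=> r e; apply: no; exists r.
  have : g (a - z%:A) = 0 by apply: gz; exists 1; rewrite mul1r.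
  rewrite lrmorphB lrmorph_alg ga0 sub0r => /eqP.
  by rewrite oppr_eq0 -[_%:A]/(z * 1) mulr1 (negPf z0).
have [rs [ds rs0]] := split_annihilator a.
rewrite -(subnKC ds) exprD.
suff -> : a ^+ size rs = 0 by rewrite mul0r.
suff nil y : \prod_(z <- rs) (a - z%:A) * y = 0 -> a ^+ size rs * y = 0.
  by rewrite -[LHS]mulr1 nil // rs0 mul0r.
elim: rs {ds rs0} y => [|z rs IHrs] y; first by rewrite big_nil /= expr0.
rewrite big_cons /= -mulrA mulrCA => h.
rewrite exprSr -mulrA; apply: IHrs.
have [z0|z0] := eqVneq z 0; first by rewrite z0 scale0r subr0 in h.
have [r er] := unit_sub z z0.
set P := \prod_(_ <- _) _ in h *.
by rewrite -[y]mul1r -er -mulrA (mulrCA P) (mulrCA P) h !mulr0.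
Qed.

(** Dedekind's independence of characters. *)
Lemma points_independent m (g : 'I_m -> points A k^o) (c : 'I_m -> k) :
  injective g -> (forall a, \sum_i c i * g i a = 0) -> forall i, c i = 0.
Proof.
elim: m g c => [|m IHm] g c g_inj cg; first by case.
have c_lift i : c (lift ord0 i) = 0.
  apply/eqP/negP => /negP ci0.
  have : ~ g (lift ord0 i) = g ord0.
    by move/g_inj/eqP; rewrite eq_sym (negPf (neq_lift _ _)).
  apply; apply: points_ext => a.
  suff /eqP : c (lift ord0 i) * (g (lift ord0 i) a - g ord0 a) = 0.
    by rewrite mulf_eq0 (negPf ci0) subr_eq0 => /eqP.
  apply: (IHm (fun i => g (lift ord0 i))
    (fun i => c (lift ord0 i) * (g (lift ord0 i) a - g ord0 a))).
    by move=> i1 i2 /g_inj/lift_inj.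
  (* Eliminate g ord0 between the relation at a * x and g ord0 a times the    *)
  (* relation at x.                                                          *)
  move=> x.
  have := cg (a * x); have := congr1 (fun y => g ord0 a * y) (cg x).
  rewrite mulr0 => e0 e1; have := etrans (congr2 (fun x y => x - y) e1 e0) (subrr 0).
  rewrite !big_ord_recl mulrDr !lrmorphM opprD addrACA.
  have -> : c ord0 * (g ord0 a * g ord0 x) - g ord0 a * (c ord0 * g ord0 x) = 0 by ring.
  rewrite add0r mulr_sumr -sumrB => e2; rewrite -[RHS]e2; apply: eq_bigr => i' _.
  by rewrite lrmorphM; ring.
move=> i; case: (unliftP ord0 i) => [i' ->|->]; first exact: c_lift.
have := cg 1; rewrite big_ord_recl lrmorph1 mulr1 big1 ?addr0 // => i' _.
by rewrite c_lift mul0r.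
Qed.

Lemma points_bound m (g : 'I_m -> points A k^o) : injective g -> (m <= d)%N.
Proof.
move=> g_inj; rewrite leqNgt; apply/negP => dm.
have [u u0 uM] := left_kernel_vector (\matrix_(i, j) (g i (b j) : k)) dm.
case/eqP: u0; apply/rowP => i; rewrite mxE.
apply: (points_independent g_inj) => a; have [c ->] := b_spans a.
under eq_bigr => i' _.
  rewrite lrmorph_sum mulr_sumr; under eq_bigr => j _ do rewrite lrmorphZ. over.
rewrite exchange_big big1 // => j _ /=.
have /rowP/(_ j) := uM; rewrite !mxE => e.
rewrite -[RHS](mulr0 (c j)) -[X in _ = _ * X]e mulr_sumr; apply: eq_bigr => i' _.
by rewrite !mxE; rewrite -[_ *: _]/(c j * _); ring.
Qed.

(** An injective family of points that misses a point can be extended, and its length is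
    bounded by d. *)
Lemma finitely_many_points : exists N (g : 'I_N -> points A k^o),
  injective g /\ forall x, exists i, g i = x.
Proof.
suff /(_ d.+1) [[g /points_bound]|//] : forall m,
    (exists g : 'I_m -> points A k^o, injective g) \/
    exists N (g : 'I_N -> points A k^o), injective g /\ forall x, exists i, g i = x.
  by rewrite ltnn.
elim=> [|m [[g g_inj]|]]; [|  |by right].
  by left; exists (fun i : 'I_0 => False_rect _ (notF (ltn_ord i))) => -[].
have [g_surj|] := classic (forall x, exists i, g i = x).
  by right; exists m, g.
move=> /not_all_ex_not [x no_x]; left.
exists (fun i => oapp g x (unlift ord0 i)) => i i'.
case: (unliftP ord0 i) => [i1 ->|->]; case: (unliftP ord0 i') => [i2 ->|->] //=.
- by move/g_inj ->.
- by move=> e; case: no_x; exists i1.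
- by move=> e; case: no_x; exists i2.
Qed.

End FiniteAlgebra.

(** * Tensor products *)

Definition independent (k : fieldType) (A : comAlgType k) m (x : 'I_m -> A) :=
  forall c : 'I_m -> k, \sum_i c i *: x i = 0 -> forall i, c i = 0.

Lemma basis_exists (k : fieldType) (A : comAlgType k) d (b : 'I_d -> A) :
  spans b -> exists D (e : 'I_D -> A), spans e /\ independent e.
Proof.
elim: d b => [|d IHd] b b_spans; first by exists 0%N, b; split=> // c _ [].
case: (classic (independent b)) => [bI|]; first by exists d.+1, b.
move=> nb; have [c hc] := not_all_ex_not _ _ nb; have [cb nc] := imply_to_and _ _ hc.
have [i0 /eqP ci0] := not_all_ex_not _ _ nc.
apply: (IHd (fun i => b (lift i0 i))) => a; have [c' ->] := b_spans a.
exists (fun i => c' (lift i0 i) - c' i0 / c i0 * c (lift i0 i)).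
rewrite (bigD1_ord i0) //= in cb *; rewrite (bigD1_ord i0) //=.
under [in RHS]eq_bigr => i _ do rewrite scalerBl -scalerA.
rewrite big_split /= addrC; congr (_ + _).
rewrite sumrN -scaler_sumr; move/eqP: cb; rewrite addrC addr_eq0 => /eqP ->.
by rewrite scalerN opprK scalerA divfK.
Qed.

Lemma dual_functional (k : fieldType) (A : comAlgType k) d (b : 'I_d -> A)
    m (x : 'I_m -> A) (i : 'I_m) :
  spans b -> independent x ->
  exists f : {linear A -> k^o}, forall j, f (x j) = (j == i)%:R.
Proof.
move=> /basis_exists [D [e [e_spans e_ind]]] x_ind.
pose c a := sval (constructive_indefinite_description _ (e_spans a)).
have cE a : a = \sum_l c a l *: e l.
  exact: svalP (constructive_indefinite_description _ (e_spans a)).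
have c_uniq a c' : a = \sum_l c' l *: e l -> forall l, c a l = c' l.
  move=> ec' l; apply/eqP; rewrite -subr_eq0; apply/eqP.
  move: l; apply: e_ind; under eq_bigr => l _ do rewrite scalerBl.
  by rewrite sumrB -cE -ec' subrr.
pose X := \matrix_(j, l) c (x j) l.
have /row_freeP [Y XY] : row_free X.
  apply/inj_row_free => u uX; apply/rowP => j; rewrite mxE.
  move: j; apply: x_ind; under eq_bigr => j _ do rewrite [x j]cE scaler_sumr.
  rewrite exchange_big big1 //= => l _.
  under eq_bigr => j _ do rewrite scalerA.
  rewrite -scaler_suml; have /rowP/(_ l) := uX; rewrite !mxE.
  by under eq_bigr => j _ do rewrite mxE; move=> ->; rewrite scale0r.
pose f (a : A) : k^o := \sum_l c a l * Y l i.
have f_lin : linear f.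
  move=> z a a'; rewrite /f scaler_sumr -big_split /=; apply: eq_bigr => l _.
  rewrite (c_uniq _ (fun l => z * c a l + c a' l)).
    by rewrite mulrDl -mulrA.
  under eq_bigr => l' _ do rewrite scalerDl -scalerA.
  by rewrite big_split /= -scaler_sumr -!cE.
pose fM := GRing.isLinear.Build k A k^o _ f f_lin.
pose fL : {linear A -> k^o} := HB.pack f fM.
exists fL => j; rewrite /= /f.
have /matrixP/(_ j i) := XY; rewrite !mxE => <-.
by apply: eq_bigr => l _; rewrite mxE.
Qed.

Section Tensor.
Variables (k : fieldType) (A B : comAlgType k).
Variables (dA : nat) (bA : 'I_dA -> A) (d : nat) (b : 'I_d -> B).
Hypotheses (bA_spans : spans bA) (b_spans : spans b).

Let mulfun (f : {linear A -> k^o}) (a : A) (x : A) : k^o := f (a * x).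
Let mulfun_lin f a : linear (mulfun f a).
Proof. by move=> z x y; rewrite /mulfun mulrDr -scalerAr linearP. Qed.
HB.instance Definition _ f a :=
  GRing.isLinear.Build k A k^o _ (mulfun f a) (mulfun_lin f a).

Let coef (f : {linear A -> k^o}) (a : A) : B := (f a)%:A.
Let coef_additive f : zmod_morphism (coef f).
Proof. by move=> x y; rewrite /coef linearB scalerBl. Qed.
HB.instance Definition _ f := GRing.isZmodMorphism.Build A B (coef f) (coef_additive f).

(** The image of F in A (x) B, contracted with the functional f on A. *)
Let pair (f : {linear A -> k^o}) (F : {mpoly A[d]}) : B := mmap (coef f) b F.

Let pair_monomial f a m : pair f (a *: 'X_[m]) = f a *: mmap1 b m.
Proof.
rewrite /pair; have [->|a0] := eqVneq a 0.
  by rewrite scale0r mmap0 linear0 scale0r.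
rewrite /mmap msuppMCX // big_seq1 mcoeffZ mcoeffX eqxx mulr1 /coef.
by rewrite mulr_algl.
Qed.

Let pairD f F G : pair f (F + G) = pair f F + pair f G.
Proof. exact: mmapD. Qed.

Let pairM f a m F :
  pair f ((a *: 'X_[m]) * F) = mmap1 b m * pair (mulfun f a) F.
Proof.
elim/mpolyind: F => [|c m' F _ _ IHF].
  by rewrite mulr0 /pair !mmap0 mulr0.
rewrite mulrDr !pairD IHF mulrDr; congr (_ + _).
rewrite -scalerAl -scalerAr scalerA -mpolyXD !pair_monomial /mulfun.
rewrite commr_mmap1_M; last by move=> *; exact: mulrC.
by rewrite -scalerAr.
Qed.

Let inA (p : {mpoly k[d]}) : {mpoly A[d]} := map_mpoly (in_alg A) p.
Let evB (p : {mpoly k[d]}) : B := mmap (in_alg B) b p.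

Let pair_inA f p : pair f (inA p) = f 1 *: evB p.
Proof.
elim/mpolyind: p => [|c m p _ _ IHp].
  by rewrite /inA /evB rmorph0 /pair !mmap0 scaler0.
rewrite /inA /evB rmorphD /= pairD -/(inA p) IHp mmapD scalerDr; congr (_ + _).
rewrite map_mpolyZ map_mpolyX pair_monomial mmapZ mmapX /=.
by rewrite linearZ mulr_algl !scalerA mulrC.
Qed.

(** R is A (x) B, obtained from A[y_1, ..., y_d] by mapping y_i to b_i and dividing by
    the polynomials that pair to 0 with every functional on A.  The separation property is the
    only trait of a tensor product that is used. *)
Lemma tensor_exists : exists (R : comAlgType k) (iA : {lrmorphism A -> R})
    (iB : {lrmorphism B -> R}),
  forall m (x : 'I_m -> A) (y : 'I_m -> B), independent x ->
    \sum_i iA (x i) * iB (y i) = 0 -> forall i, y i = 0.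
Proof.
pose J (F : {mpoly A[d]}) := forall f, pair f F = 0.
have [||R [q [qc qsurj qker]]] := @quotient_exists k {mpoly A[d]}
    (@mpolyC d A \o in_alg A : {rmorphism k -> {mpoly A[d]}}) J.
- split; first by move=> f; rewrite /pair mmap0.
    by move=> F G JF JG f; rewrite pairD JF JG addr0.
  move=> G F JF f; elim/mpolyind: G => [|c m G _ _ IHG].
    by rewrite mul0r /pair mmap0.
  by rewrite mulrDl pairD IHG addr0 pairM JF mulr0.
- move=> J1; have one_ind : independent (fun _ : 'I_1 => 1 : A).
    move=> c; rewrite big_ord1 => /eqP c0 i; apply/eqP; apply: contraTT c0 => c0.
    rewrite (ord1 i) in c0; apply/eqP => /(congr1 (fun z => (c 0)^-1 *: z)).
    by rewrite scalerA mulVf // scale1r scaler0 => /eqP; rewrite oner_eq0.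
  have [f f1] := dual_functional 0 bA_spans one_ind.
  have := J1 f; rewrite /pair -[1]/(1%:MP) mmapC => e.
  have/eqP := oner_neq0 B; apply; rewrite -[RHS]e /coef.
  by have := f1 0; rewrite eqxx => f1E; rewrite [X in _ = X *: _]f1E scale1r.
have [|||iA iAE] := @make_lrmorphism k A R (q \o @mpolyC d A).
- move=> a x y /=; rewrite mpolyCD rmorphD /=; congr (_ + _).
  by rewrite -[a *: x]mulr_algl mpolyCM rmorphM /= (qc a) mulr_algl.
- by rewrite /= rmorph1.
- by move=> x y; rewrite /= mpolyCM rmorphM.
have inAZ c p : q (inA (c *: p)) = c *: q (inA p).
  by rewrite /inA map_mpolyZ /= -mul_mpolyC rmorphM /= (qc c) mulr_algl.
pose E (y : B) (z : R) := exists p, evB p = y /\ q (inA p) = z.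
have [|||||iB iBE] := @graph_lrmorphism k B R E.
- move=> y; have [c ->] := b_spans y.
  exists (q (inA (\sum_i c i *: 'X_i))), (\sum_i c i *: 'X_i); split=> //.
  rewrite /evB rmorph_sum /=; apply: eq_bigr => i _.
  by rewrite mmapZ mmapX mmap1U /= mulr_algl.
- move=> z [p [p0 <-]]; apply/qker => f.
  by rewrite pair_inA p0 scaler0.
- move=> a _ _ _ _ [p [<- <-]] [p' [<- <-]]; exists (a *: p + p').
  rewrite /evB mmapD mmapZ /= mulr_algl; split=> //.
  by rewrite -inAZ /inA !rmorphD.
- move=> _ _ _ _ [p [<- <-]] [p' [<- <-]]; exists (p * p').
  by rewrite /evB /inA !rmorphM.
- by exists 1; rewrite /evB /inA !rmorph1.
exists R, iA, iB => m x y x_ind xy0 i.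
pose p j := sval (constructive_indefinite_description _ (iBE (y j))).
have pP j : evB (p j) = y j /\ q (inA (p j)) = iB (y j).
  exact: svalP (constructive_indefinite_description _ (iBE (y j))).
have [f fx] := dual_functional i bA_spans x_ind.
have Jxp : J (\sum_j (x j)%:MP * inA (p j)).
  apply/qker; rewrite rmorph_sum -[RHS]xy0; apply: eq_bigr => j _.
  by rewrite rmorphM /= (pP j).2 iAE.
have := Jxp f; rewrite /pair raddf_sum /=.
under eq_bigr => j _.
  rewrite -/(pair f _) -[(x j)%:MP]mulr1 -[1](@mpolyX0 d A) mul_mpolyC pairM.
  rewrite mmap11 mul1r pair_inA (pP j).1 /= /mulfun mulr1 fx. over.
rewrite (bigD1 i) //= eqxx scale1r big1 ?addr0 // => j /negPf ->.
by rewrite scale0r.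
Qed.

End Tensor.

(** * Eigenvectors of trigonalizable groups *)

Section GroupLaws.
Variables (k : fieldType) (G : group_scheme k) (R : comAlgType k).
Implicit Types x y : points (coord_ring G) R.

Lemma gmulVr x : gmul x (ginv x) = gone G R.
Proof.
set y := ginv x; rewrite -[LHS]gmul1 -{1}(gmulV y) -gmulA (gmulA y x y).
by rewrite [gmul y x]gmulV gmul1 gmulV.
Qed.

Lemma gmul1r x : gmul x (gone G R) = x.
Proof. by rewrite -(gmulV x) gmulA gmulVr gmul1. Qed.

Lemma gmul_idem x : gmul x x = x -> x = gone G R.
Proof. by move=> xx; rewrite -(gmulV x) -{3}xx gmulA gmulV gmul1. Qed.

End GroupLaws.

Section Homomorphisms.
Variables (k : fieldType) (H G : group_scheme k).
Variable (i : {lrmorphism coord_ring G -> coord_ring H}).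
Hypothesis i_hom : group_hom i.

Lemma hom_one (R : comAlgType k) :
  (gone H R \o i : points (coord_ring G) R) = gone G R.
Proof. by apply: gmul_idem; rewrite -i_hom gmul1. Qed.

Lemma hom_representation n (rho : 'M[coord_ring G]_n) :
  is_representation rho -> is_representation (map_mx i rho).
Proof.
move=> rhoP R; have [rho1 rhoM] := rhoP R; split.
  by rewrite -map_mx_comp -rho1 -hom_one.
by move=> g h; rewrite -!map_mx_comp -rhoM -i_hom.
Qed.

Lemma hom_character chi : is_character chi -> is_character (i chi).
Proof.
move=> chiP R; have [chi1 chiM] := chiP R; split.
  by rewrite -chi1 -hom_one.
move=> g h; rewrite -[LHS]/((gmul g h \o i : points _ R) chi) i_hom.
exact: chiM.
Qed.

End Homomorphisms.

Section CharacterExpansion.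
Variables (k : fieldType) (A : comAlgType k) (n : nat).
Variable (P : A -> Prop).

(** For P the predicate of being a character and u the orbit v rho of a vector v, this is
    the expansion of v rho into characters. *)
Definition expands (u : 'rV[A]_n) m (x : 'I_m -> A) (w : 'I_m -> 'rV[k]_n) :=
  (forall i, P (x i)) /\ u = \sum_i x i *: map_mx (in_alg A) (w i).

Lemma expand_independent u m (x : 'I_m -> A) w : expands u x w ->
  exists m' (x' : 'I_m' -> A) w', expands u x' w' /\ independent x'.
Proof.
elim: m x w => [|m IHm] x w uxw; first by exists 0%N, x, w; split=> // c _ [].
case: (classic (independent x)) => [xI|]; first by exists m.+1, x, w.
move=> nx; have [c hc] := not_all_ex_not _ _ nx; have [cx nc] := imply_to_and _ _ hc.
have [i0 /eqP ci0] := not_all_ex_not _ _ nc.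
apply: (IHm (fun i => x (lift i0 i))
  (fun i => w (lift i0 i) - (c (lift i0 i) / c i0) *: w i0)).
have [Px ->] := uxw; split=> [i|]; first exact: Px.
rewrite (bigD1_ord i0) //= in cx *; rewrite (bigD1_ord i0) //= addrC.
(* Substitute for x i0 its expression through the other x i. *)
have -> : x i0 = \sum_i - (c (lift i0 i) / c i0) *: x (lift i0 i).
  under eq_bigr => i _ do rewrite scaleNr mulrC -scalerA.
  rewrite sumrN -scaler_sumr; move/eqP: cx; rewrite addr_eq0 => /eqP e.
  by rewrite -scalerN -e scalerA mulVf // scale1r.
rewrite scaler_suml -big_split /=; apply: eq_bigr => i _.
apply/rowP => j; rewrite !mxE /= scalerBl mulrBr; congr (_ + _).
by move: (c _ / _) => r; rewrite scaleNr mulNr -scalerA -scalerAl scalerAr.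
Qed.

Lemma expands_exists (u : 'rV[A]_n) :
  (forall j, exists m (c : 'I_m -> k) (x : 'I_m -> A),
    (forall i, P (x i)) /\ u 0 j = \sum_i c i *: x i) ->
  exists m (x : 'I_m -> A) w, expands u x w.
Proof.
move=> uP; rewrite [u]row_sum_delta; elim/big_ind: _ => [|u1 u2|j _].
- by exists 0%N, (fun=> 0), (fun=> 0); split=> [[]//|]; rewrite big_ord0.
- move=> [m1 [x1 [w1 [P1 ->]]]] [m2 [x2 [w2 [P2 ->]]]].
  exists (m1 + m2)%N, (fun i => match split i with inl i1 => x1 i1 | inr i2 => x2 i2 end),
    (fun i => match split i with inl i1 => w1 i1 | inr i2 => w2 i2 end).
  split=> [i|]; first by case: split => i'; [exact: P1|exact: P2].
  rewrite big_split_ord /=; congr (_ + _); apply: eq_bigr => i _.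
    by rewrite (unsplitK (inl i)).
  by rewrite (unsplitK (inr i)).
have [m [c [x [Px ->]]]] := uP j; exists m, x, (fun i => c i *: delta_mx 0 j).
split=> //; rewrite scaler_suml; apply: eq_bigr => i _.
rewrite map_mxZ map_delta_mx scalerA; congr (_ *: _).
by rewrite -mulr_algl mulrC.
Qed.

End CharacterExpansion.

Section Eigenline.
Variables (k : closedFieldType) (G : group_scheme k).
Hypothesis finG : finite_group_scheme G.
Hypothesis trigG : trigonalizable_group_scheme G.
Local Notation A := (coord_ring G).

Lemma map_in_alg (R S : comAlgType k) (g : {lrmorphism R -> S}) n m
    (v : 'M[k]_(n, m)) :
  map_mx g (map_mx (in_alg R) v) = map_mx (in_alg S) v.
Proof. by apply/matrixP => a b; rewrite !mxE /= lrmorph_alg. Qed.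

(** The vector is a coefficient w_i in the expansion of v rho into independent characters,
    for a vector v fixed by the unipotent subgroup.  Independence allows comparing
    coefficients over A (x) A. *)
Lemma eigenline n (rho : 'M[A]_n) : (0 < n)%N -> is_representation rho ->
  exists (v : 'rV[k]_n) (chi : A),
    [/\ v != 0, is_character chi
      & map_mx (in_alg A) v *m rho = chi *: map_mx (in_alg A) v].
Proof.
move=> n0 rhoP.
have [N [Q [i [q [[[i_hom _] normN] uniN [q_hom _ quotQ] diagQ]]]]] := trigG.
have [v v0 vfix] := uniN n _ n0 (hom_representation i_hom rhoP).
have orbit (R : comAlgType k) (g : points A R) :
    map_mx g (map_mx (in_alg A) v *m rho) = map_mx (in_alg R) v *m map_mx g rho.
  by rewrite map_mxM (map_in_alg g).
have [m [x [w /expand_independent]]] :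
    exists m (x : 'I_m -> A) w,
      expands (@is_character k G) (map_mx (in_alg A) v *m rho) x w.
  apply: expands_exists => j.
  (* The coefficients of v rho are functions on the quotient: g n = n' g for   *)
  (* points g of G and n of the normal subgroup, and n' fixes v.              *)
  have [c qc] : exists c, q c = (map_mx (in_alg A) v *m rho) 0 j.
    apply/quotQ => R g h; have [h' h'E] := normN R g h.
    have gh : gmul g (h \o i : points A R) = gmul (h' \o i : points A R) g.
      by rewrite h'E -gmulA gmulV gmul1r.
    have gE (g' : points A R) : g' ((map_mx (in_alg A) v *m rho) 0 j) =
        (map_mx (in_alg R) v *m map_mx g' rho) 0 j.
      by rewrite -(orbit R g') [RHS]mxE.
    rewrite !gE gh; have [_ ->] := rhoP R; rewrite mulmxA.
    by have := vfix R h'; rewrite -map_mx_comp => ->.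
  have [d [e [chi [chiP cE]]]] := diagQ c.
  exists d, e, (fun l => q (chi l)); split=> [l|]; first exact: hom_character.
  by rewrite -qc cE lrmorph_sum; apply: eq_bigr => l _; rewrite lrmorphZ.
move=> [m' [x' [w' [[x'P vE] x'I]]]] {m x w}.
(* At the neutral element all characters are 1. *)
have vS : v = \sum_i w' i.
  have := congr1 (map_mx (gone G k^o)) vE; rewrite orbit (rhoP k^o).1 mulmx1.
  rewrite map_mx_sum => e; apply/rowP => j; move/rowP/(_ j): e.
  have kA (z : k) : in_alg k^o z = z by exact: mulr1.
  rewrite mxE !summxE kA => ->; apply: eq_bigr => l _.
  rewrite !mxE -[LHS]/(gone G k^o (x' l * (w' l 0 j)%:A)).
  by rewrite lrmorphM lrmorph_alg (x'P l k^o).1 mul1r; exact: kA.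
have [l wl0] : exists l, w' l != 0.
  apply: NNPP => nw; case/eqP: v0; rewrite vS big1 // => l _.
  by apply/eqP; apply: contraT => wl; case: nw; exists l.
exists (w' l), (x' l); split=> //.
have [d [b b_spans]] := finG.
have [R [iA [iB sep]]] := tensor_exists b_spans b_spans.
apply/rowP => j; apply/eqP; rewrite -subr_eq0; apply/eqP.
pose y l := (map_mx (in_alg A) (w' l) *m rho) 0 j - (x' l *: map_mx (in_alg A) (w' l)) 0 j.
move: l {wl0}; apply: (sep _ x' y) => //.
(* Expand v rho(g h) = v rho(g) rho(h) at g = iA and h = iB. *)
have := orbit R (gmul iA iB); rewrite (rhoP R).2 mulmxA -orbit vE.
rewrite !map_mx_sum mulmx_suml => /rowP/(_ j); rewrite !summxE => e.
rewrite /y; under eq_bigr => l _ do rewrite lrmorphB mulrBr.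
apply/eqP; rewrite sumrB subr_eq0; apply/eqP.
apply: etrans (etrans (esym e) _); apply: eq_bigr => l _.
  have -> : map_mx iA (x' l *: map_mx (in_alg A) (w' l)) =
      iA (x' l) *: map_mx iB (map_mx (in_alg A) (w' l)).
    by rewrite map_mxZ (map_in_alg iA) (map_in_alg iB).
  by rewrite -scalemxAl -map_mxM !mxE.
rewrite !mxE; have [_ xM] := x'P l R.
rewrite -[LHS]/(gmul iA iB (x' l * (w' l 0 j)%:A)) !lrmorphM xM !lrmorph_alg.
by rewrite mulrA.
Qed.

End Eigenline.

(** * Evaluation and linear substitution *)

Lemma mpoly_rmorph_ext n (R : nzRingType) (S : comNzRingType)
    (f g : {rmorphism {mpoly R[n]} -> S}) :
  (forall c, f c%:MP = g c%:MP) -> (forall i, f 'X_i = g 'X_i) -> f =1 g.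
Proof.
move=> fgC fgX F; elim/mpolyind: F => [|c m F _ _ IH]; first by rewrite !rmorph0.
rewrite !rmorphD /= IH -mul_mpolyC !rmorphM /= fgC; congr (_ * _ + _).
rewrite mpolyXE_id !rmorph_prod; apply: eq_bigr => i _.
by rewrite !rmorphXn /= fgX.
Qed.

Section Evaluation.
Variables (k : fieldType) (R : comAlgType k) (n : nat).

Definition eval_at (v : 'rV[R]_n) : {mpoly k[n]} -> R := mmap (in_alg R) (v 0).
HB.instance Definition _ v := GRing.RMorphism.copy (eval_at v) (mmap (in_alg R) (v 0)).
Let eval_at_scalable v : scalable (eval_at v).
Proof. by move=> c f; rewrite /eval_at mmapZ /= mulr_algl. Qed.
HB.instance Definition _ v :=
  GRing.isScalable.Build k {mpoly k[n]} R *:%R (eval_at v) (eval_at_scalable v).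

Definition eval_pt (v : 'rV[R]_n) : {lrmorphism affine_space k n -> R} := eval_at v.

Lemma eval_atX v i : eval_at v 'X_i = v 0 i.
Proof. by rewrite /eval_at mmapX mmap1U. Qed.

Lemma affine_point_eval (x : points (affine_space k n) R) : x =1 eval_at (coords x).
Proof.
apply: (@mpoly_rmorph_ext n k R x (eval_at (coords x))) => [c|i] /=.
  by rewrite -[c%:MP]mulr1 mul_mpolyC -[RHS]/(eval_pt (coords x) _) !lrmorph_alg.
by rewrite eval_atX mxE.
Qed.

End Evaluation.

Lemma eval_at_map (k : fieldType) (R S : comAlgType k) (g : {lrmorphism R -> S})
    n (v : 'rV[R]_n) f : g (eval_at v f) = eval_at (map_mx g v) f.
Proof.
apply: (@mpoly_rmorph_ext n k S (g \o eval_at v) (eval_at (map_mx g v))) => [a|i] /=.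
  by rewrite /eval_at !mmapC /= lrmorph_alg.
by rewrite !eval_atX mxE.
Qed.

Section Scalars.
Variables (k : fieldType) (A : comAlgType k).

(** The structure map of A as a morphism of k-algebras. *)
Definition scalars (z : k^o) : A := z%:A.

Let scalars_linear : linear scalars.
Proof. by move=> a x y; rewrite /scalars scalerDl scalerA. Qed.
HB.instance Definition _ := GRing.isLinear.Build k k^o A _ scalars scalars_linear.
Let scalars_monoid : monoid_morphism scalars.
Proof.
split=> [|x y]; first exact: scale1r.
by rewrite /scalars mulr_algl scalerA.
Qed.
HB.instance Definition _ := GRing.isMonoidMorphism.Build k^o A scalars scalars_monoid.

Lemma eval_at_scalars n (v : 'rV[k]_n) f :
  eval_at (map_mx (in_alg A) v) f = (eval_at (v : 'rV[k^o]_n) f)%:A.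
Proof. by rewrite -(eval_at_map (scalars : {lrmorphism k^o -> A})). Qed.

End Scalars.

Section LinearSubstitution.
Variables (R : comNzRingType) (n : nat).

(** On polynomial functions, this is precomposition with v |-> v *m M. *)
Definition lin_sub (M : 'M[R]_n) : {mpoly R[n]} -> {mpoly R[n]} :=
  mmap (@mpolyC n R) (fun j => \sum_i M i j *: 'X_i).
HB.instance Definition _ M :=
  GRing.RMorphism.copy (lin_sub M) (mmap (@mpolyC n R) (fun j => \sum_i M i j *: 'X_i)).

Lemma lin_subC M c : lin_sub M c%:MP = c%:MP.
Proof. exact: mmapC. Qed.

Lemma lin_subX M j : lin_sub M 'X_j = \sum_i M i j *: 'X_i.
Proof. by rewrite /lin_sub mmapX mmap1U. Qed.

Lemma lin_subZ M c f : lin_sub M (c *: f) = c *: lin_sub M f.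
Proof. by rewrite /lin_sub mmapZ /= mul_mpolyC. Qed.

Lemma lin_sub_mul M N f : lin_sub M (lin_sub N f) = lin_sub (M *m N) f.
Proof.
apply: (@mpoly_rmorph_ext n R _ (lin_sub M \o lin_sub N) (lin_sub (M *m N))) => [c|j] /=.
  by rewrite !lin_subC.
rewrite !lin_subX rmorph_sum /=.
under eq_bigr => i _ do rewrite lin_subZ lin_subX scaler_sumr.
rewrite exchange_big; apply: eq_bigr => l _ /=; rewrite mxE scaler_suml.
by apply: eq_bigr => i _; rewrite scalerA mulrC.
Qed.

Lemma lin_sub1 f : lin_sub 1%:M f = f.
Proof.
apply: (@mpoly_rmorph_ext n R _ (lin_sub 1%:M) (idfun : {rmorphism _ -> _})) => [c|j] /=.
  exact: lin_subC.
rewrite lin_subX (bigD1 j) //= mxE eqxx scale1r big1 ?addr0 // => i /negPf ij.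
by rewrite mxE ij scale0r.
Qed.

Lemma lin_subK M N : N *m M = 1%:M -> cancel (lin_sub M) (lin_sub N).
Proof. by move=> NM f; rewrite lin_sub_mul NM lin_sub1. Qed.

End LinearSubstitution.

Lemma map_lin_sub (R S : comNzRingType) n (g : {rmorphism R -> S}) (M : 'M[R]_n) f :
  map_mpoly g (lin_sub M f) = lin_sub (map_mx g M) (map_mpoly g f).
Proof.
apply: (@mpoly_rmorph_ext n R _ (map_mpoly g \o lin_sub M)
  (lin_sub (map_mx g M) \o map_mpoly g)) => [c|j] /=.
  by rewrite lin_subC map_mpolyC lin_subC.
rewrite lin_subX map_mpolyX lin_subX rmorph_sum /=; apply: eq_bigr => i _.
by rewrite map_mpolyZ map_mpolyX mxE.
Qed.

Section Coefficients.
Variables (k : fieldType) (A : comAlgType k) (n : nat).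

Definition in_coef : {mpoly k[n]} -> {mpoly A[n]} := map_mpoly (in_alg A).
HB.instance Definition _ := GRing.RMorphism.copy in_coef (map_mpoly (in_alg A)).

Lemma in_coefC c : in_coef c%:MP = (c%:A)%:MP.
Proof. exact: map_mpolyC. Qed.

(** The leading coefficient of a nonzero c is an invertible scalar, even where A has zero
    divisors. *)
Lemma in_coef_regular (c : {mpoly k[n]}) (F : {mpoly A[n]}) :
  in_coef c * F = 0 -> c = 0 \/ F = 0.
Proof.
move=> cF; have [->|c0] := eqVneq c 0; first by left.
right; apply/eqP; apply: contraTT isT => F0.
have : mleadc (in_coef c) != 0.
  rewrite mleadc_eq0; apply: contraNneq c0 => e; apply/eqP/mpolyP => m.
  have := congr1 (mcoeff m) e; rewrite mcoeff_map_mpoly mcoeff0 /= => /eqP.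
  by rewrite scaler_eq0 oner_eq0 orbF mcoeff0 => /eqP.
rewrite mcoeff_map_mpoly /=; set z := c@__ => z0.
have {}z0 : z != 0 by apply: contraNneq z0 => ->; rewrite scale0r.
have := mleadcM (in_coef c) F; rewrite cF mcoeff0 mcoeff_map_mpoly -/z mulr_algl.
move=> /esym/eqP; rewrite scaler_eq0 (negPf z0) mleadc_eq0.
by rewrite (negPf F0).
Qed.

Definition evalA (R : comAlgType k) (g : {lrmorphism A -> R}) (v : 'rV[R]_n) :
  {mpoly A[n]} -> R := mmap g (v 0).
HB.instance Definition _ R g v :=
  GRing.RMorphism.copy (@evalA R g v) (mmap g (v 0)).

Lemma evalA_in_coef R g v f : @evalA R g v (in_coef f) = eval_at v f.
Proof.
apply: (@mpoly_rmorph_ext n k R (evalA g v \o in_coef) (eval_at v)) => [c|j] /=.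
  rewrite /in_coef map_mpolyC /evalA mmapC /= lrmorph_alg.
  by rewrite /eval_at mmapC.
by rewrite /in_coef map_mpolyX /evalA mmapX mmap1U eval_atX.
Qed.

Lemma evalA_lin_sub R g v (M : 'M[A]_n) F :
  @evalA R g v (lin_sub M F) = evalA g (v *m map_mx g M) F.
Proof.
apply: (@mpoly_rmorph_ext n A R (evalA g v \o lin_sub M) (evalA g (v *m map_mx g M)))
  => [c|j] /=.
  by rewrite lin_subC /evalA !mmapC.
rewrite lin_subX rmorph_sum /= [RHS]/evalA mmapX mmap1U mxE; apply: eq_bigr => i _.
by rewrite /evalA mmapZ mmapX mmap1U mxE mulrC.
Qed.

End Coefficients.

Arguments in_coef {k} A {n} _.

(** * Separating one variable, and Zariski density *)

Lemma poly_rmorph_ext (R : nzRingType) (S : nzRingType) (f g : {rmorphism {poly R} -> S}) :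
  (forall c, f c%:P = g c%:P) -> f 'X = g 'X -> f =1 g.
Proof.
move=> fgC fgX p; elim/poly_ind: p => [|p c IH]; first by rewrite !rmorph0.
by rewrite !rmorphD !rmorphM /= IH fgX fgC.
Qed.

Section SplitVariable.
Variables (R : comNzRingType) (n : nat).

(** The first of the n + 1 variables becomes the variable of the univariate polynomials, to
    match block matrices of size 1 + n. *)
Definition uni_var (i : 'I_n.+1) : {poly {mpoly R[n]}} :=
  oapp (fun j => ('X_j)%:P) 'X (unlift ord0 i).

Definition to_uni : {mpoly R[n.+1]} -> {poly {mpoly R[n]}} :=
  mmap (polyC \o @mpolyC n R) uni_var.
HB.instance Definition _ :=
  GRing.RMorphism.copy to_uni (mmap (polyC \o @mpolyC n R) uni_var).

Definition widen0 : {mpoly R[n]} -> {mpoly R[n.+1]} :=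
  mmap (@mpolyC n.+1 R) (fun j => 'X_(lift ord0 j)).
HB.instance Definition _ :=
  GRing.RMorphism.copy widen0 (mmap (@mpolyC n.+1 R) (fun j => 'X_(lift ord0 j))).

Definition of_uni : {poly {mpoly R[n]}} -> {mpoly R[n.+1]} :=
  horner_eval 'X_ord0 \o map_poly widen0.
HB.instance Definition _ :=
  GRing.RMorphism.copy of_uni (horner_eval 'X_ord0 \o map_poly widen0).

Lemma to_uniC c : to_uni c%:MP = (c%:MP)%:P.
Proof. exact: mmapC. Qed.

Lemma to_uniX0 : to_uni 'X_ord0 = 'X.
Proof. by rewrite /to_uni mmapX mmap1U /uni_var unlift_none. Qed.

Lemma to_uniXl j : to_uni 'X_(lift ord0 j) = ('X_j)%:P.
Proof. by rewrite /to_uni mmapX mmap1U /uni_var liftK. Qed.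

Lemma of_uniC f : of_uni f%:P = widen0 f.
Proof. by rewrite /of_uni /= /horner_eval map_polyC hornerC. Qed.

Lemma of_uniX : of_uni 'X = 'X_ord0.
Proof. by rewrite /of_uni /= /horner_eval map_polyX hornerX. Qed.

Lemma widen0C c : widen0 c%:MP = c%:MP.
Proof. exact: mmapC. Qed.

Lemma widen0X j : widen0 'X_j = 'X_(lift ord0 j).
Proof. by rewrite /widen0 mmapX mmap1U. Qed.

Lemma to_uniK : cancel to_uni of_uni.
Proof.
apply: (@mpoly_rmorph_ext n.+1 R _ (of_uni \o to_uni) (idfun : {rmorphism _ -> _}))
  => [c|i] /=.
  by rewrite to_uniC of_uniC widen0C.
case: (unliftP ord0 i) => [j ->|->]; first by rewrite to_uniXl of_uniC widen0X.
by rewrite to_uniX0 of_uniX.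
Qed.

Lemma of_uniK : cancel of_uni to_uni.
Proof.
apply: (@poly_rmorph_ext _ _ (to_uni \o of_uni) (idfun : {rmorphism _ -> _})) => [f|] /=.
  rewrite of_uniC.
  apply: (@mpoly_rmorph_ext n R _ (to_uni \o widen0) polyC) => [c|j] /=.
    by rewrite widen0C to_uniC.
  by rewrite widen0X to_uniXl.
by rewrite of_uniX to_uniX0.
Qed.

Lemma to_uni_widen0 f : to_uni (widen0 f) = f%:P.
Proof. by rewrite -of_uniC of_uniK. Qed.

Lemma widen0_inj : injective widen0.
Proof.
move=> f g e; have := congr1 to_uni e; rewrite (to_uni_widen0 f) (to_uni_widen0 g).
exact: polyC_inj.
Qed.

End SplitVariable.

Lemma to_uni_map (R S : comNzRingType) n (g : {rmorphism R -> S}) (F : {mpoly R[n.+1]}) :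
  to_uni (map_mpoly g F) = map_poly (map_mpoly g) (to_uni F).
Proof.
apply: (@mpoly_rmorph_ext n.+1 R _ (@to_uni S n \o map_mpoly g)
  (map_poly (map_mpoly g) \o @to_uni R n)) => [c|i] /=.
  by rewrite map_mpolyC !to_uniC map_polyC /= map_mpolyC.
rewrite map_mpolyX; case: (unliftP ord0 i) => [j ->|->].
  by rewrite !to_uniXl map_polyC /= map_mpolyX.
by rewrite !to_uniX0 map_polyX.
Qed.

Lemma horner_to_uni (k : fieldType) (A R : comAlgType k) (g : {lrmorphism A -> R})
    n (v : 'rV[R]_n) z (F : {mpoly A[n.+1]}) :
  (map_poly (evalA g v) (to_uni F)).[z] = evalA g (row_mx z%:M v : 'rV_(1 + n)) F.
Proof.
apply: (@mpoly_rmorph_ext n.+1 A R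
  (horner_eval z \o map_poly (evalA g v) \o @to_uni A n)
  (evalA g (row_mx z%:M v : 'rV_(1 + n)))) => [c|i] /=.
  by rewrite /horner_eval to_uniC map_polyC hornerC /= /evalA !mmapC.
rewrite /horner_eval [RHS]/evalA mmapX mmap1U.
case: (unliftP ord0 i) => [j ->|->].
  rewrite to_uniXl map_polyC hornerC /= /evalA mmapX mmap1U.
  have -> : lift ord0 j = rshift 1 j by apply/val_inj.
  by rewrite [RHS](@row_mxEr _ 1 1 n).
rewrite to_uniX0 map_polyX hornerX.
have -> : ord0 = lshift n (0 : 'I_1) by apply/val_inj.
by rewrite [RHS](@row_mxEl _ 1 1 n) mxE.
Qed.

Section InfiniteField.
Variable (k : closedFieldType).

Lemma fresh_scalar (s : seq k) : exists z, z \notin s.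
Proof.
case: s => [|a s]; first by exists 0.
pose p : {poly k} := \prod_(z <- a :: s) ('X - z%:P) + 1.
have sp : size p = (size s).+2.
  by rewrite size_polyDl size_prod_XsubC // size_poly1.
have /closed_rootP [z pz] : size p != 1%N by rewrite sp.
exists z; apply: contraL pz => zs.
rewrite /root hornerD hornerC.
have /rootP -> : root (\prod_(z <- a :: s) ('X - z%:P)) z by rewrite root_prod_XsubC.
by rewrite add0r oner_eq0.
Qed.

(** Differences of distinct scalars are invertible in A, so the linear factors of
    infinitely many roots can be divided out one after the other. *)
Lemma poly_vanish (A : comAlgType k) (p : {poly A}) :
  (forall z : k, p.[z%:A] = 0) -> p = 0.
Proof.
suff gen m (q : {poly A}) (s : seq k) : (size q <= m)%N ->
    (forall z, z \notin s -> q.[z%:A] = 0) -> q = 0.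
  by move=> p0; apply: (gen (size p) p [::]).
elim: m q s => [|m IHm] q s; first by rewrite leqn0 size_poly_eq0 => /eqP.
move=> qm q0; have [a as_] := fresh_scalar s.
have /factor_theorem [r er] : root q a%:A by apply/rootP/q0.
have [r0|r0] := eqVneq r 0; first by rewrite er r0 mul0r.
rewrite er (IHm r (a :: s)) ?mul0r //.
  move: qm; rewrite er size_Mmonic ?monicXsubC // size_XsubC addn2 /=.
  by rewrite ltnS.
move=> z; rewrite inE negb_or => /andP [za zs].
have := q0 z zs; rewrite er hornerM hornerXsubC -scalerBl -scalerAr mulr1.
by move=> /eqP; rewrite scaler_eq0 subr_eq0 (negPf za) => /eqP.
Qed.

Variable (A : comAlgType k).

Lemma mpoly_vanish n (F : {mpoly A[n]}) :
  (forall v : 'rV[k]_n, evalA (idfun : {lrmorphism A -> A}) (map_mx (in_alg A) v) F = 0) ->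
  F = 0.
Proof.
elim: n F => [|n IHn] F F0.
  apply/mpolyP => m; have := F0 0; rewrite mcoeff0 => <-.
  have -> : F = F@_0 *: 'X_[0%MM].
    rewrite {1}[F]mpolyE; have [F00|F00] := eqVneq F@_0 0.
      rewrite F00 scale0r big1_seq // => m' /andP [_]; rewrite mcoeff_msupp.
      by rewrite (_ : m' = 0%MM) ?F00 ?eqxx //; apply/mnmP => -[].
    rewrite (bigD1_seq 0%MM) ?msupp_uniq ?mcoeff_msupp //= big1 ?addr0 // => m'.
    by rewrite (_ : m' = 0%MM) ?eqxx //; apply/mnmP => -[].
  rewrite mpolyX0 /evalA mmapZ rmorph1 mulr1 /= mcoeffZ mcoeff1.
  by rewrite (_ : m = 0%MM) ?eqxx ?mulr1 //; apply/mnmP => -[].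
rewrite -[F]to_uniK; suff -> : to_uni F = 0 by rewrite rmorph0.
apply/polyP => i; rewrite coef0; apply: IHn => v.
pose ev := evalA (idfun : {lrmorphism A -> A}) (map_mx (in_alg A) v).
rewrite -[LHS](coef_map ev) -/ev; suff -> : map_poly ev (to_uni F) = 0 by rewrite coef0.
apply: poly_vanish => z; rewrite horner_to_uni.
have -> : row_mx z%:A%:M (map_mx (in_alg A) v) = map_mx (in_alg A) (row_mx z%:M v).
  by rewrite map_row_mx map_scalar_mx.
exact: F0.
Qed.

Lemma mpoly_dense_vanish n (c : {mpoly k[n]}) (F : {mpoly A[n]}) : c != 0 ->
  (forall v : 'rV[k]_n, eval_at (v : 'rV[k^o]_n) c != 0 ->
     evalA (idfun : {lrmorphism A -> A}) (map_mx (in_alg A) v) F = 0) ->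
  F = 0.
Proof.
move=> c0 F0; have : in_coef A c * F = 0; last first.
  by case/in_coef_regular => // /eqP; rewrite (negPf c0).
apply: mpoly_vanish => v; rewrite rmorphM /= evalA_in_coef.
have [cv|/F0 ->] := eqVneq (eval_at (v : 'rV[k^o]_n) c) 0; last by rewrite mulr0.
by rewrite eval_at_scalars cv scale0r mul0r.
Qed.

End InfiniteField.

(** * Invariant polynomials *)

(** This is f (v rho) = f v for the universal vector v and the universal point of
    Spec A. *)
Definition is_invariant (k : fieldType) (A : comAlgType k) n (rho : 'M[A]_n)
  (f : {mpoly k[n]}) : Prop := lin_sub rho (in_coef A f) = in_coef A f.

Lemma invariant_const (k : fieldType) (A : comAlgType k) n (rho : 'M[A]_n) c :
  is_invariant rho c%:MP.
Proof. by rewrite /is_invariant in_coefC lin_subC. Qed.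

Lemma invariant_eval (k : fieldType) (A R : comAlgType k) n (rho : 'M[A]_n) f
    (g : points A R) (v : 'rV[R]_n) :
  is_invariant rho f -> eval_at (v *m map_mx g rho) f = eval_at v f.
Proof.
by move=> fI; rewrite -(evalA_in_coef g) -evalA_lin_sub fI evalA_in_coef.
Qed.

Lemma invariant_of_eval (k : closedFieldType) (A : comAlgType k) n (rho : 'M[A]_n)
    (c f : {mpoly k[n]}) : c != 0 ->
  (forall v : 'rV[k]_n, eval_at (v : 'rV[k^o]_n) c != 0 ->
    eval_at (map_mx (in_alg A) v *m rho) f = eval_at (map_mx (in_alg A) v) f) ->
  is_invariant rho f.
Proof.
move=> c0 fI; apply/eqP; rewrite -subr_eq0; apply/eqP/(mpoly_dense_vanish c0) => v cv.
rewrite rmorphB /= evalA_lin_sub !evalA_in_coef (_ : map_mx idfun rho = rho).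
  by rewrite fI // subrr.
by apply/matrixP => i j; rewrite mxE.
Qed.

Section FiniteGroup.
Variables (k : closedFieldType) (p : nat) (char_k : p \in [pchar k]).
Variables (G : group_scheme k) (finG : finite_group_scheme G).
Local Notation A := (coord_ring G).

Lemma points_reindex N (g : 'I_N -> points A k^o) (x : points A k^o)
    (F : points A k^o -> k) :
  injective g -> (forall y, exists i, g i = y) ->
  \prod_i F (gmul x (g i)) = \prod_i F (g i).
Proof.
move=> g_inj g_surj.
pose s i := sval (constructive_indefinite_description _ (g_surj (gmul x (g i)))).
have sE i : g (s i) = gmul x (g i).
  exact: svalP (constructive_indefinite_description _ (g_surj (gmul x (g i)))).
have s_inj : injective s.
  move=> i i' e; apply: g_inj; have := congr1 g e; rewrite !sE => e'.
  by rewrite -(gmul1 (g i)) -(gmulV x) -gmulA e' gmulA gmulV gmul1.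
by rewrite [RHS](reindex_inj s_inj); apply: eq_bigr => i _; rewrite sE.
Qed.

(** All points kill a - z, so it is nilpotent, and a power of Frobenius, which is
    additive, maps a and z to the same element. *)
Lemma frobenius_of_points : exists2 m : nat, (0 < m)%N &
  forall (a : A) (z : k), (forall g : points A k^o, g a = z) -> a ^+ m = (z ^+ m)%:A.
Proof.
have p_pr : prime p by exact: pcharf_prime char_k.
have [d [b b_spans]] := finG.
have char_A : p \in [pchar A] by exact: (rmorph_pchar (in_alg A) char_k).
exists (p ^ d)%N => [|a z az]; first by rewrite expn_gt0 prime_gt0.
have nil : (a - z%:A) ^+ (p ^ d) = 0.
  have dm : (d <= p ^ d)%N by exact/ltnW/ltn_expl/prime_gt1.
  rewrite -(subnKC dm) exprD (nilpotent_of_points b_spans) ?mul0r // => g.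
  by rewrite lrmorphB lrmorph_alg az [_%:A]mulr1 subrr.
have : (a - z%:A + z%:A) ^+ (p ^ d) = (a - z%:A) ^+ (p ^ d) + z%:A ^+ (p ^ d).
  by rewrite exprDn_pchar // pnatX pnatE // char_A.
by rewrite subrK nil add0r => ->; rewrite -(rmorphXn (in_alg A)).
Qed.

(** Multiplication by a k-point g of G permutes the N points of G, which gives
    chi(g)^N = 1.  Hence chi^N and 1 agree at all points. *)
Lemma character_finite_order (chi : A) : is_character chi ->
  exists2 m : nat, (0 < m)%N & chi ^+ m = 1.
Proof.
move=> chiP; have [d [b b_spans]] := finG.
have [N [g [g_inj g_surj]]] := finitely_many_points b_spans.
have N0 : (0 < N)%N.
  by have [[i iN] _] := g_surj (gone G k^o); exact: leq_ltn_trans (leq0n i) iN.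
have [m m0 mP] := frobenius_of_points.
exists (N * m)%N; first by rewrite muln_gt0 N0.
rewrite exprM (mP _ 1) ?expr1n ?scale1r // => x.
have [chi1 chiM] := chiP k^o.
have := points_reindex x (fun y : points A k^o => y chi : k) g_inj g_surj.
under eq_bigr => i _ do rewrite chiM.
rewrite big_split /= prodr_const card_ord lrmorphX => e.
have nz : \prod_i (g i chi : k) != 0.
  apply/prodf_neq0 => i _; apply/eqP => gi0.
  have := chi1; rewrite -(gmulV (g i)) chiM gi0 mulr0.
  by move/esym/eqP; rewrite oner_eq0.
by apply: (mulIf nz); rewrite mul1r.
Qed.

Variables (n : nat) (rho : 'M[A]_n).
Hypothesis rhoP : is_representation rho.

(** At a vector v, the product of the translates of s by the k-points of G, evaluated at
    v rho, has the same value at each k-point of G, because multiplication by this point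
    permutes the factors.  A suitable power of it is therefore constant on G. *)
Lemma invariant_multiple (s : {mpoly k[n]}) : s != 0 ->
  exists h u : {mpoly k[n]}, [/\ h != 0, is_invariant rho h & h = u * s].
Proof.
move=> s0; have [d [b b_spans]] := finG.
have [N [g [g_inj g_surj]]] := finitely_many_points b_spans.
have [m m0 mP] := frobenius_of_points.
pose sub (x : points A k^o) : {mpoly k[n]} -> {mpoly k[n]} :=
  lin_sub (map_mx x rho : 'M[k]_n).
have sub1 f : sub (gone G k^o) f = f by rewrite /sub (rhoP k^o).1 lin_sub1.
have subM x y f : sub x (sub y f) = sub (gmul x y) f.
  by rewrite /sub (rhoP k^o).2 lin_sub_mul.
have sub0 x : sub x s != 0.
  apply: contraNneq s0 => e; rewrite -(sub1 s) -(gmulV x) -subM e.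
  by rewrite /sub rmorph0.
have sub_eval x f (v : 'rV[k^o]_n) : eval_at v (sub x f) = eval_at (v *m map_mx x rho) f.
  apply: (@mpoly_rmorph_ext n k k^o (eval_at v \o lin_sub (map_mx x rho : 'M[k]_n))
    (eval_at (v *m map_mx x rho))) => [c|j] /=.
    by rewrite lin_subC /eval_at !mmapC.
  rewrite lin_subX rmorph_sum /= eval_atX mxE; apply: eq_bigr => i _.
  by rewrite linearZ /= eval_atX mulrC !mxE.
(* h0 is divisible by s because the neutral element is one of the g i. *)
pose h0 := \prod_i sub (g i) s.
exists (h0 ^+ m); have [i0 gi0] := g_surj (gone G k^o).
exists (h0 ^+ m.-1 * \prod_(i | i != i0) sub (g i) s); split.
- by rewrite expf_neq0 //; apply/prodf_neq0 => i _; exact: sub0.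
- apply: (@invariant_of_eval _ _ _ _ 1); first by rewrite oner_eq0.
  move=> v _; rewrite !rmorphXn /= eval_at_scalars.
  rewrite (mP _ (eval_at (v : 'rV[k^o]_n) h0)); first exact: (rmorphXn (in_alg A)).
  move=> x; rewrite eval_at_map map_mxM (map_in_alg x).
  have -> : map_mx (in_alg k^o) v = v by apply/matrixP => i j; rewrite mxE; exact: mulr1.
  pose F (y : points A k^o) : k := eval_at (v : 'rV[k^o]_n) (sub y s).
  rewrite !rmorph_prod /= -[RHS](points_reindex x F g_inj g_surj) /F.
  by apply: eq_bigr => i _; rewrite -subM [RHS]sub_eval.
have eh : h0 = s * \prod_(i | i != i0) sub (g i) s.
  by rewrite /h0 (bigD1 i0) //= gi0 sub1.
by rewrite -mulrA [_ * s]mulrC -eh -exprSr prednK.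
Qed.

End FiniteGroup.

(** * Miyata's argument in one variable *)

Section AffineSubstitution.
Variables (R : comNzRingType) (a b : R).

Lemma size_comp_affine (f : {poly R}) :
  (size (f \Po (a *: 'X + b%:P))%R <= size f)%N.
Proof.
have [->|f0] := eqVneq f 0; first by rewrite comp_poly0.
apply: leq_trans (size_comp_poly_leq _ _) _.
have sl : (size (a *: 'X + b%:P)%R <= 2)%N.
  apply: leq_trans (size_polyD _ _) _; rewrite geq_max.
  rewrite (leq_trans (size_scale_leq _ _)) ?size_polyX //=.
  exact: leq_trans (size_polyC_leq1 _) _.
move: f0; rewrite -size_poly_gt0; case: (size f) => // m _ /=; rewrite ltnS.
by rewrite -[leqRHS]muln1 leq_mul2l; case: (size _) sl => [|[|[]]]; rewrite ?orbT.
Qed.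

Lemma coef_comp_affine (f : {poly R}) d : (size f <= d.+1)%N ->
  (f \Po (a *: 'X + b%:P))`_d = f`_d * a ^+ d.
Proof.
elim/poly_ind: f d => [|f c IHf] d; first by rewrite comp_poly0 coef0 mul0r.
have [->|f0] := eqVneq f 0.
  rewrite mul0r add0r comp_polyC => _; rewrite coefC.
  by case: d => [|d]; rewrite ?expr0 ?mulr1 //= mul0r.
rewrite size_MXaddC (negPf f0) /= comp_polyD comp_polyM comp_polyX comp_polyC.
case: d => [|d]; first by rewrite ltnS leqn0 size_poly_eq0 (negPf f0).
rewrite ltnS => fd; rewrite mulrDr !coefD coefMC -scalerAr coefZ !coefMX !coefC /= !addr0.
rewrite IHf // [X in _ + X * b]nth_default ?mul0r ?addr0.
  by rewrite exprS mulrCA.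
exact: leq_trans (size_comp_affine _) fd.
Qed.

End AffineSubstitution.

Section Miyata.
Variables (B : idomainType) (B' : comNzRingType) (io r : {rmorphism B -> B'}).
Hypothesis io_regular : forall c F, io c * F = 0 -> c = 0 \/ F = 0.
Variables (chi beta : B') (N : nat).
Hypotheses (N_gt0 : (0 < N)%N) (chiN : chi ^+ N = 1).

(** The extension of r to B[X] with X |-> chi X + beta. *)
Definition affine_coact (f : {poly B}) : {poly B'} :=
  map_poly r f \Po (chi *: 'X + beta%:P).

Definition coinv (b : B) : Prop := r b = io b.
Definition poly_coinv (f : {poly B}) : Prop := affine_coact f = map_poly io f.

Let sigD f g : affine_coact (f + g) = affine_coact f + affine_coact g.
Proof. by rewrite /affine_coact rmorphD comp_polyD. Qed.
Let sigM f g : affine_coact (f * g) = affine_coact f * affine_coact g.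
Proof. by rewrite /affine_coact rmorphM comp_polyM. Qed.
Let sigC c : affine_coact c%:P = (r c)%:P.
Proof. by rewrite /affine_coact map_polyC comp_polyC. Qed.

Lemma coinvX b e : coinv b -> coinv (b ^+ e).
Proof. by rewrite /coinv !rmorphXn /= => ->. Qed.
Lemma coinvM b c : coinv b -> coinv c -> coinv (b * c).
Proof. by rewrite /coinv !rmorphM /= => -> ->. Qed.

Lemma poly_coinv_const f : poly_coinv f -> (size f <= 1)%N -> coinv f`_0.
Proof.
move=> fI /size1_polyC ef; rewrite ef /poly_coinv sigC map_polyC /= in fI.
exact: (polyC_inj fI).
Qed.

(** The generator th is an invariant of least positive degree, and h is a power of its
    leading coefficient.  The two alternatives correspond to the existence of th. *)
Lemma miyata :
  (forall f, poly_coinv f -> (size f <= 1)%N) \/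
  exists (th : {poly B}) (h : B),
    [/\ (1 < size th)%N, poly_coinv th, h != 0, coinv h
      & forall f, poly_coinv f -> exists e (Q : {poly B}),
          (forall i, coinv Q`_i) /\ h ^+ e *: f = Q \Po th].
Proof.
case: (classic (forall f, poly_coinv f -> (size f <= 1)%N)) => [con|ncon]; first by left.
right.
have [th [thI th1 th_min]] : exists th : {poly B},
    [/\ poly_coinv th, (1 < size th)%N
      & forall f, poly_coinv f -> (size f < size th)%N -> (size f <= 1)%N].
  apply: NNPP => no_min; apply: ncon.
  suff gen m (f : {poly B}) : (size f <= m)%N -> poly_coinv f -> (size f <= 1)%N.
    by move=> f; exact: (gen (size f)).
  elim: m f => [|m IHm] f fm fI; first exact: leq_trans fm _.
  rewrite leqNgt; apply/negP => f1; apply: no_min; exists f; split=> // g gI gf.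
  by apply: IHm gI; rewrite -ltnS (leq_trans gf).
set d := (size th).-1; have sth : size th = d.+1 by rewrite prednK // ltnW.
have d0 : (0 < d)%N by rewrite -ltnS -sth.
set c := lead_coef th; have c0 : c != 0 by rewrite lead_coef_eq0 -size_poly_gt0 sth.
have thd : (map_poly io th)`_d = io c by rewrite coef_map.
have hI : coinv (c ^+ N).
  have := congr1 (fun f : {poly B'} => f`_d) thI.
  rewrite coef_comp_affine; last by rewrite -sth; exact: size_poly.
  rewrite thd coef_map -/(lead_coef th) -/c /= => e.
  by rewrite /coinv !rmorphXn /= -e exprMn -exprM mulnC exprM chiN expr1n mulr1.
set h := c ^+ N in hI *.
exists th, h; split=> //; first by rewrite expf_neq0.
move=> f; move: {2}(size f) (leqnn (size f)) => m; elim: m f => [|m IHm] f fm fI.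
  move: fm; rewrite leqn0 size_poly_eq0 => /eqP ->; exists 0%N, 0.
  by rewrite comp_poly0 scaler0; split=> // i; rewrite coef0 /coinv !rmorph0.
have [f1|f1] := leqP (size f) 1.
  exists 0%N, f; split=> [i|]; last by rewrite expr0 scale1r [f]size1_polyC // comp_polyC.
  case: i => [|i]; first exact: poly_coinv_const.
  by rewrite nth_default ?(leq_trans f1) // /coinv !rmorph0.
have fth : (size th <= size f)%N.
  by rewrite leqNgt; apply/negP => /(th_min _ fI); rewrite leqNgt f1.
have [e0 [q [r0 [qr rth]]]] : exists e0 q r0,
    h ^+ e0 *: f = q * th + r0 /\ (size r0 < size th)%N.
  (* The multiplier c ^+ scalp is completed to a power of h = c ^+ N. *)
  exists (Pdiv.Idomain.scalp f th), (c ^+ (N.-1 * Pdiv.Idomain.scalp f th) *: (f %/ th)),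
    (c ^+ (N.-1 * Pdiv.Idomain.scalp f th) *: (f %% th)); split; last first.
    rewrite (leq_ltn_trans (size_scale_leq _ _)) // Pdiv.Idomain.ltn_modp.
    by rewrite -size_poly_gt0 sth.
  rewrite -scalerAl -scalerDr -Pdiv.Idomain.divp_eq scalerA -exprD /h -exprM.
  by rewrite -mulSnr prednK.
have hfI : poly_coinv (q * th + r0).
  rewrite -qr /poly_coinv -mul_polyC sigM fI sigC rmorphM /= map_polyC /=.
  by rewrite [r _](coinvX _ hI).
(* Uniqueness of the division: D times a polynomial of degree d with regular *)
(* leading coefficient has degree less than d, so D vanishes.                *)
pose D := affine_coact q - map_poly io q.
have eD : D * map_poly io th = map_poly io r0 - affine_coact r0.
  move: hfI; rewrite /poly_coinv sigD sigM thI rmorphD rmorphM /= => e.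
  by rewrite mulrBl; apply/eqP; rewrite subr_eq addrAC eq_sym subr_eq addrC e addrC.
have D0 : D = 0.
  apply/eqP; apply: contraTT isT => D0; have := leqnn (size th); rewrite sth.
  have sD : (size (D * map_poly io th)%R <= d)%N.
    rewrite eD -ltnS -sth (leq_ltn_trans (size_polyD _ _)) // gtn_max size_polyN.
    apply/andP; split; first exact: leq_ltn_trans (size_poly _ _) rth.
    apply: leq_ltn_trans (size_comp_affine _ _ _) _.
    exact: leq_ltn_trans (size_poly _ _) rth.
  have ioc0 : io c != 0.
    apply: contraNneq c0 => ioc.
    have /io_regular [->|/eqP] : io c * 1 = 0 by rewrite ioc mul0r.
      by rewrite eqxx.
    by rewrite oner_eq0.
  have: (size (D * map_poly io th)%R = (size D + d.+1).-1)%N.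
    rewrite size_proper_mul ?size_map_poly_id0 ?sth //.
    rewrite lead_coef_map_eq -/c // mulrC; apply/eqP => /io_regular [/eqP|/eqP].
      by rewrite (negPf c0).
    by rewrite lead_coef_eq0 (negPf D0).
  rewrite addnS /= => eS; move: sD; rewrite eS -{2}[d]add0n leq_add2r leqn0.
  by rewrite size_poly_eq0 (negPf D0).
have qI : poly_coinv q by apply/eqP; rewrite -subr_eq0 -/D D0.
have rI : poly_coinv r0.
  by apply/eqP; rewrite eq_sym -subr_eq0 -eD D0 mul0r.
have r1 : (size r0 <= 1)%N by exact: th_min.
have qf : (size q < size f)%N.
  have [->|q0] := eqVneq q 0; first by rewrite size_poly0 (leq_trans _ f1).
  have: (size (q * th)%R <= size f)%N.
    have -> : q * th = h ^+ e0 *: f - r0 by rewrite qr addrK.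
    rewrite (leq_trans (size_polyD _ _)) // geq_max size_scale_leq size_polyN.
    by rewrite ltnW // (leq_trans rth).
  rewrite size_mul // -?size_poly_gt0 ?sth // addnS /=; apply: leq_trans.
  by rewrite -[ltnLHS]addn0 ltn_add2l.
have [e1 [Q [QI eQ]]] : exists e1 (Q : {poly B}),
    (forall i, coinv Q`_i) /\ h ^+ e1 *: q = Q \Po th.
  by apply: IHm => //; rewrite -ltnS (leq_trans qf).
exists (e1 + e0)%N, (Q * 'X + (h ^+ e1 * r0`_0)%:P); split=> [i|].
  rewrite coefD coefMX coefC; case: i => [|i] /=; rewrite ?add0r ?addr0 //.
  by apply: coinvM; [exact: coinvX|exact: poly_coinv_const].
rewrite exprD -scalerA qr scalerDr comp_polyD comp_polyM comp_polyX comp_polyC -eQ.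
by rewrite scalerAl polyCM mul_polyC -(size1_polyC r1).
Qed.

End Miyata.

(** * Triangular coordinates *)

Lemma unit_completion (k : fieldType) n (v : 'rV[k]_n.+1) : v != 0 ->
  exists2 T : 'M_n.+1, T \in unitmx & row 0 T = v.
Proof.
move=> v0; have rv : \rank v = 1%N by rewrite rank_rV v0.
have := mulmx_ebase v; rewrite rv; set a := col_ebase v.
have -> : a = (a 0 0)%:M by rewrite {1}[a]mx11_scalar.
rewrite mul_scalar_mx -scalemxAl => ev.
have a0 : a 0 0 != 0.
  apply: contraNneq v0 => e; by rewrite -ev e scale0r.
exists (a 0 0 *: row_ebase v).
  by rewrite unitmxZ ?unitfE // row_ebase_unit.
rewrite linearZ /= rowE -[RHS]ev; congr (_ *: (_ *m _)).
apply/rowP => j; rewrite !mxE /=.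
by rewrite -(inj_eq val_inj) /= andbT eq_sym.
Qed.

Section Triangular.
Variables (R : comNzRingType) (n : nat) (M : 'M[R]_(1 + n)) (chi : R).
Hypothesis Mu : usubmx M = row_mx chi%:M 0.

Definition tail_shift : {mpoly R[n]} := \sum_i dlsubmx M i 0 *: 'X_i.

(** As the first row of M is (chi, 0), the substitution maps x_0 to chi x_0 + tail_shift M
    and the other variables to combinations of each other. *)
Lemma to_uni_lin_sub (F : {mpoly R[1 + n]}) :
  to_uni (lin_sub M F) =
  map_poly (lin_sub (drsubmx M)) (to_uni F) \Po (chi%:MP *: 'X + tail_shift%:P).
Proof.
apply: (@mpoly_rmorph_ext (1 + n) R _ (@to_uni R n \o lin_sub M)
  (comp_poly (chi%:MP *: 'X + tail_shift%:P) \o map_poly (lin_sub (drsubmx M))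
   \o @to_uni R n)) => [c|j] /=.
  by rewrite lin_subC !to_uniC map_polyC /= lin_subC comp_polyC.
rewrite lin_subX rmorph_sum /= big_split_ord /= big_ord1.
have toZ c i : to_uni (c *: 'X_i : {mpoly R[n.+1]}) = c%:MP *: to_uni 'X_i.
  by rewrite -mul_mpolyC rmorphM /= to_uniC mul_polyC.
rewrite toZ; under eq_bigr => i _ do rewrite toZ.
have l0 : lshift n (0 : 'I_1) = ord0 :> 'I_n.+1 by apply/val_inj.
have rl i : rshift 1 i = lift ord0 i :> 'I_n.+1 by apply/val_inj.
rewrite l0 to_uniX0; under eq_bigr => i _ do rewrite rl to_uniXl.
case: (unliftP ord0 j) => [j' ->|->].
  rewrite to_uniXl map_polyC comp_polyC /= lin_subX rmorph_sum /=.
  have -> : M ord0 (lift ord0 j') = 0.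
    have /rowP/(_ (rshift 1 j')) := Mu; rewrite row_mxEr !mxE => <-.
    by congr (M _ _); apply/val_inj.
  rewrite scale0r add0r; apply: eq_bigr => i _.
  by rewrite -mul_polyC -polyCM mul_mpolyC !mxE !rl.
rewrite to_uniX0 map_polyX comp_polyX; congr (_%:MP *: _ + _).
  have /rowP/(_ (lshift n 0)) := Mu; rewrite row_mxEl !mxE eqxx mulr1n => <-.
  by congr (M _ _); apply/val_inj.
rewrite /tail_shift rmorph_sum; apply: eq_bigr => i _ /=.
rewrite -mul_polyC -polyCM mul_mpolyC !mxE rl; congr ((M _ _ *: _)%:P).
by apply/val_inj.
Qed.

End Triangular.

Section InvariantTransport.
Variables (k : fieldType) (A : comAlgType k) (n : nat).

Section Conjugation.
Variables (rho : 'M[A]_n) (T : 'M[k]_n).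
Hypothesis T_unit : T \in unitmx.
Let TA := map_mx (in_alg A) T.
Let VA := map_mx (in_alg A) (invmx T).

(** Conjugation of rho by T corresponds to the change of coordinates v |-> v *m T. *)
Lemma invariant_conj f :
  is_invariant rho f <-> is_invariant (TA *m rho *m VA) (lin_sub T f).
Proof.
have VT : VA *m TA = 1%:M by rewrite -map_mxM mulVmx // map_mx1.
have TV : TA *m VA = 1%:M by rewrite -map_mxM mulmxV // map_mx1.
have inT : in_coef A (lin_sub T f) = lin_sub TA (in_coef A f).
  exact: (map_lin_sub (in_alg A)).
rewrite /is_invariant inT lin_sub_mul -!mulmxA VT mulmx1 -lin_sub_mul.
split=> [->|e]; first exact: erefl.
exact: (can_inj (lin_subK VT) e).
Qed.

End Conjugation.

Variables (M : 'M[A]_(1 + n)) (chi : A).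
Hypothesis Mu : usubmx M = row_mx chi%:M 0.

Lemma invariant_uni (F : {mpoly k[1 + n]}) :
  is_invariant M F <->
  poly_coinv (in_coef A) (lin_sub (drsubmx M) \o in_coef A : {rmorphism _ -> _})
    chi%:MP (tail_shift M) (to_uni F).
Proof.
have inF : to_uni (in_coef A F) = map_poly (in_coef A) (to_uni F).
  exact: (to_uni_map (in_alg A)).
rewrite /is_invariant /poly_coinv /affine_coact map_poly_comp -inF -(to_uni_lin_sub Mu).
split=> [->|e]; first exact: erefl.
exact: (can_inj (@to_uniK A n) e).
Qed.

End InvariantTransport.

Section RepresentationTransport.
Variables (k : closedFieldType) (G : group_scheme k).
Local Notation A := (coord_ring G).

Lemma representation_conj n (rho : 'M[A]_n) (T : 'M[k]_n) : T \in unitmx ->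
  is_representation rho ->
  is_representation (map_mx (in_alg A) T *m rho *m map_mx (in_alg A) (invmx T)).
Proof.
move=> T_unit rhoP R; have [rho1 rhoM] := rhoP R.
have VT : map_mx (in_alg R) (invmx T) *m map_mx (in_alg R) T = 1%:M.
  by rewrite -map_mxM mulVmx // map_mx1.
have gE (g : points A R) :
    map_mx g (map_mx (in_alg A) T *m rho *m map_mx (in_alg A) (invmx T)) =
    map_mx (in_alg R) T *m map_mx g rho *m map_mx (in_alg R) (invmx T).
  by rewrite !map_mxM !(map_in_alg g).
split=> [|g h]; rewrite !gE.
  by rewrite rho1 mulmx1 -map_mxM mulmxV // map_mx1.
rewrite rhoM -!mulmxA; congr (_ *m (_ *m _)).
by rewrite [RHS]mulmxA VT mul1mx.
Qed.

Lemma representation_drsub n (M : 'M[A]_(1 + n)) : ursubmx M = 0 ->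
  is_representation M -> is_representation (drsubmx M).
Proof.
move=> M0 MP R; have [M1 MM] := MP R.
split=> [|g h]; rewrite !map_drsubmx.
  by rewrite M1 scalar_mx_block block_mxKdr.
rewrite MM -[X in drsubmx (X *m _)]submxK -[X in drsubmx (_ *m X)]submxK.
rewrite mulmx_block block_mxKdr -[X in _ *m X + _]map_ursubmx M0.
by rewrite map_mx0 mulmx0 add0r.
Qed.

End RepresentationTransport.

(** * Rationality of the ring of invariants *)

(** Up to inverting t, the elements satisfying P form a polynomial ring over k; this is
    the form, for rings, of a field of invariants being purely transcendental. *)
Definition rational_chart (k : fieldType) (C : comNzRingType) (ka : {rmorphism k -> C})
    (P : C -> Prop) : Prop :=
  exists m (phi : {rmorphism {mpoly k[m]} -> C}) (t : {mpoly k[m]}),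
    [/\ injective phi, forall c, phi c%:MP = ka c, forall q, P (phi q), t != 0
      & forall f, P f -> exists e q, phi t ^+ e * f = phi q].

Lemma rational_chart_transport (k : fieldType) (C D : comNzRingType)
    (kC : {rmorphism k -> C}) (kD : {rmorphism k -> D}) (P : C -> Prop) (Q : D -> Prop)
    (f : {rmorphism C -> D}) (g : {rmorphism D -> C}) :
  cancel f g -> cancel g f -> (forall c, f (kC c) = kD c) ->
  (forall x, Q x <-> P (g x)) ->
  rational_chart kC P -> rational_chart kD Q.
Proof.
move=> fK gK fk QP [m [phi [t [phi_inj phik phiP t0 phi_gen]]]].
exists m, (f \o phi : {rmorphism _ -> _}), t; split.
- by apply: inj_comp phi_inj; exact: can_inj fK.
- by move=> c; rewrite -fk -phik.
- by move=> q; apply/QP; rewrite /= fK.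
- exact: t0.
move=> x /QP/phi_gen [e [q eq]]; exists e, q.
by rewrite /= -eq rmorphM rmorphXn /= gK.
Qed.

Lemma common_denominator (B C : comNzRingType) (phi : {rmorphism B -> C}) (t : B)
    (P : C -> Prop) (Q : {poly C}) :
  (forall c, P c -> exists e q, phi t ^+ e * c = phi q) -> (forall i, P Q`_i) ->
  exists e (q : {poly B}), phi t ^+ e *: Q = map_poly phi q.
Proof.
move=> phiP; elim/poly_ind: Q => [|Q c IHQ] PQ.
  by exists 0%N, 0; rewrite scaler0 rmorph0.
have [i|e [q eq]] := IHQ; first by have := PQ i.+1; rewrite coefD coefMX coefC addr0.
have [|e' [q' eq']] := phiP c; first by have := PQ 0%N; rewrite coefD coefMX coefC add0r.
exists (e + e')%N, ((t ^+ e' *: q) * 'X + (t ^+ e * q')%:P).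
rewrite rmorphD rmorphM /= map_polyX map_polyZ map_polyC /= rmorphM -eq -eq' !rmorphXn /=.
rewrite scalerDr scalerAl exprD; congr (_ * _ + _).
  by rewrite scalerA mulrC.
by rewrite -mul_polyC -polyCM -mulrA.
Qed.

Section MiyataChart.
Variables (k : fieldType) (B : idomainType) (B' : comNzRingType).
Variables (ka : {rmorphism k -> B}) (io r : {rmorphism B -> B'}).
Hypothesis io_regular : forall c F, io c * F = 0 -> c = 0 \/ F = 0.
Variables (chi beta : B') (N : nat).
Hypotheses (N_gt0 : (0 < N)%N) (chiN : chi ^+ N = 1).
Local Notation pcoinv := (poly_coinv io r chi beta).

Lemma miyata_chart : rational_chart ka (coinv io r) ->
  rational_chart (polyC \o ka : {rmorphism k -> {poly B}}) pcoinv.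
Proof.
move=> [m [phi [t [phi_inj phik phiI t0 phi_gen]]]].
have constI b : coinv io r b -> pcoinv b%:P.
  by move=> bI; rewrite /poly_coinv /affine_coact !map_polyC comp_polyC /= bI.
have [con|[th [h [th1 thI h0 hI gen]]]] :=
  @miyata _ _ io r io_regular chi beta N N_gt0 chiN.
  exists m, (polyC \o phi : {rmorphism _ -> _}), t; split.
  - exact: inj_comp (@polyC_inj _) phi_inj.
  - by move=> c; rewrite /= phik.
  - by move=> q; apply/constI.
  - exact: t0.
  move=> f fI; have f1 := con _ fI.
  have [e [q eq]] := phi_gen _ (poly_coinv_const fI f1).
  by exists e, q; rewrite (size1_polyC f1) /= -eq rmorphM rmorphXn.
have [e0 [num eh]] := phi_gen h hI.
(* The new variable goes to th; the power of h that Miyata's argument inverts *)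
(* is inverted together with num, since phi num = phi t ^+ e0 * h.             *)
pose phi' : {rmorphism {mpoly k[m.+1]} -> {poly B}} :=
  comp_poly th \o map_poly phi \o @to_uni k m.
have phi'E q : phi' q = map_poly phi (to_uni q) \Po th by [].
have phi'C q : phi' (widen0 q) = (phi q)%:P.
  by rewrite phi'E to_uni_widen0 map_polyC comp_polyC.
exists m.+1, phi', (widen0 (t * num)); split.
- apply: inj_comp; last exact: (can_inj (@to_uniK k m)).
  apply: inj_comp; last exact: map_inj_poly phi_inj (rmorph0 _).
  move=> a b /eqP; rewrite -subr_eq0 -rmorphB /= comp_poly_eq0 // subr_eq0.
  by move/eqP.
- by move=> c; rewrite -widen0C phi'C phik.
- move=> q; rewrite /poly_coinv.
  pose l := chi *: 'X + beta%:P.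
  have phiI' q' : (comp_poly l \o map_poly r) (phi' (widen0 q')) =
      map_poly io (phi' (widen0 q')).
    by rewrite phi'C; exact/constI/phiI.
  apply: (@mpoly_rmorph_ext m.+1 k _ (comp_poly l \o map_poly r \o phi')
    (map_poly io \o phi')) => [c|i].
    by rewrite -widen0C; exact: phiI'.
  case: (unliftP ord0 i) => [j ->|->]; first by rewrite -widen0X; exact: phiI'.
  have phi'X : phi' 'X_ord0 = th by rewrite phi'E to_uniX0 map_polyX comp_polyX.
  rewrite -[LHS]/((comp_poly l \o map_poly r) (phi' _)).
  by rewrite -[RHS]/(map_poly io (phi' _)) phi'X.
- rewrite -(rmorph0 (@widen0 k m)) (inj_eq (@widen0_inj k m)) mulf_neq0 //.
  apply: contraNneq h0 => th0; move: eh; rewrite th0 rmorph0 => /eqP.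
  by rewrite mulf_eq0 expf_eq0 -(rmorph0 phi) (inj_eq phi_inj) (negPf t0) andbF.
move=> f fI; have [e [Q [QI eQ]]] := gen _ fI.
have [E [Q' eQ']] := common_denominator phi_gen QI.
exists (E + e)%N, (widen0 (t ^+ (e + e0 * e) * num ^+ E) * of_uni Q').
rewrite phi'C [RHS]rmorphM phi'C.
have -> : phi' (of_uni Q') = (phi t ^+ E * h ^+ e)%:P * f.
  by rewrite phi'E of_uniK -eQ' comp_polyZ -eQ scalerA mul_polyC.
rewrite -polyC_exp mulrA -polyCM; congr (_%:P * _).
rewrite !(rmorphM phi) !(rmorphXn phi) /= -eh.
suff comb (R : comNzRingType) (a b : R) : (a * (a ^+ e0 * b)) ^+ (E + e) =
    a ^+ (e + e0 * e) * (a ^+ e0 * b) ^+ E * (a ^+ E * b ^+ e) by exact: comb.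
rewrite !exprMn !exprD !exprM; ring.
Qed.

End MiyataChart.

Lemma usubmx_delta (R : nzRingType) n (M : 'M[R]_(1 + n)) :
  usubmx M = delta_mx (0 : 'I_1) (0 : 'I_n.+1) *m M.
Proof.
rewrite -rowE; apply/rowP => j; rewrite !mxE.
by congr (M _ _); apply/val_inj.
Qed.

Section RationalInvariants.
Variables (k : closedFieldType) (p : nat) (char_k : p \in [pchar k]).
Variables (G : group_scheme k) (finG : finite_group_scheme G).
Hypothesis trigG : trigonalizable_group_scheme G.
Local Notation A := (coord_ring G).

Lemma eigenvector_block n (rho : 'M[A]_n.+1) (T : 'M[k]_n.+1) (v : 'rV[k]_n.+1) chi :
  T \in unitmx -> row 0 T = v ->
  map_mx (in_alg A) v *m rho = chi *: map_mx (in_alg A) v ->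
  usubmx (map_mx (in_alg A) T *m rho *m map_mx (in_alg A) (invmx T) : 'M_(1 + n)) =
    row_mx chi%:M 0.
Proof.
move=> T_unit Tv vchi.
have eT : delta_mx 0 0 *m map_mx (in_alg A) T = map_mx (in_alg A) v.
  by rewrite -rowE -map_row Tv.
rewrite usubmx_delta !mulmxA eT vchi -scalemxAl -eT -mulmxA -map_mxM mulmxV //.
rewrite map_mx1 mulmx1.
apply/rowP => j; case: (split_ordP j) => j' ->; rewrite ?row_mxEl ?row_mxEr !mxE.
  by rewrite !ord1 -!val_eqE /= mulr1n mulr1.
by rewrite -!val_eqE /= mulr0.
Qed.

(** In coordinates that start with an eigenvector, [miyata_chart] reduces the claim to the
    representation on the quotient by the eigenvector. *)
Theorem invariants_rational n (rho : 'M[A]_n) :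
  is_representation rho -> rational_chart (@mpolyC n k) (is_invariant rho).
Proof.
elim: n rho => [|n IHn] rho rhoP.
  exists 0%N, idfun, 1; split.
  - by [].
  - by [].
  - move=> f; apply: (@mpoly_rmorph_ext 0 k _ (lin_sub rho \o in_coef A) (in_coef A)).
      exact: (invariant_const rho).
    by move=> i; case: (notF (ltn_ord i)).
  - exact: oner_neq0.
  by move=> f _; exists 0%N, f; rewrite expr0 mul1r.
have [v [chi [v0 chiP vchi]]] := eigenline finG trigG (ltn0Sn n) rhoP.
have [T T_unit Tv] := unit_completion v0.
have [N N0 chiN] := character_finite_order char_k finG chiP.
have Mu := eigenvector_block T_unit Tv vchi.
have MP := representation_conj T_unit rhoP.
set M : 'M[A]_(1 + n) := _ *m rho *m _ in Mu MP.
have drP : is_representation (drsubmx M).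
  by apply: representation_drsub MP; rewrite -[ursubmx M]/(rsubmx (usubmx M)) Mu row_mxKr.
have chiN' : (chi%:MP : {mpoly A[n]}) ^+ N = 1 by rewrite -rmorphXn /= chiN.
have := @miyata_chart k _ _ (@mpolyC n k) (in_coef A)
  (lin_sub (drsubmx M) \o in_coef A : {rmorphism _ -> _})
  (@in_coef_regular k A n) chi%:MP (tail_shift M) N N0 chiN' (IHn _ drP).
apply: (@rational_chart_transport k _ _ _ _ _ _
  (lin_sub (invmx T) \o @of_uni k n : {rmorphism _ -> _})
  (@to_uni k n \o lin_sub T : {rmorphism _ -> _})).
- move=> F; apply: etrans (of_uniK F); congr (to_uni _).
  exact: (lin_subK (mulmxV T_unit)).
- move=> f; apply: etrans (lin_subK (mulVmx T_unit) f); congr (lin_sub _ _).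
  exact: to_uniK.
- move=> c; apply: etrans (lin_subC (invmx T) c); congr (lin_sub _ _).
  by apply: etrans (of_uniC _) _; exact: widen0C.
move=> f; apply: iff_trans (invariant_conj rho T_unit f) _.
exact: (invariant_uni Mu).
Qed.

End RationalInvariants.

(** * Retract rationality of the classifying space *)

Lemma affine_space_domain (k : fieldType) n (a b : affine_space k n) :
  a * b = 0 -> a = 0 \/ b = 0.
Proof.
by move/eqP; rewrite (@mulf_eq0 {mpoly k[n]}) => /orP [] /eqP ->; [left|right].
Qed.

Lemma affine_space_nonnilpotent (k : fieldType) n (a : affine_space k n) e :
  a ^+ e = 0 -> a = 0.
Proof. by move/eqP; rewrite (@expf_eq0 {mpoly k[n]}) => /andP [_ /eqP]. Qed.

Lemma lrmorph_mpolyC (k : fieldType) n (R : comAlgType k)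
    (f : {lrmorphism affine_space k n -> R}) (c : k) : f (c%:MP : {mpoly k[n]}) = c%:A.
Proof. by rewrite -[c%:MP]mulr1 mul_mpolyC lrmorph_alg. Qed.

Section OpenInRepresentation.
Variables (k : closedFieldType) (G : group_scheme k) (n : nat).
Local Notation A := (coord_ring G).
Variables (rho : 'M[A]_n) (U : comAlgType k) (j : {lrmorphism affine_space k n -> U}).

Lemma invariant_function_poly (f : {mpoly k[n]}) :
  is_invariant rho f -> invariant_function rho j (j f).
Proof.
move=> fI R u u' g; rewrite /vec => uu'.
rewrite -[LHS]/((u' \o j : points (affine_space k n) R) f) affine_point_eval uu'.
by rewrite (invariant_eval g _ fI) -affine_point_eval.
Qed.

(** The invariance of j f is tested on the vectors v over k with s(v) <> 0, acted upon by
    the universal point of G.  These v are dense, so this determines f (v rho) - f (v). *)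
Lemma poly_invariant_function (S : affine_space k n -> Prop) (s : {mpoly k[n]}) f :
  open_complement j S -> S s -> s != 0 -> stable_open rho j ->
  invariant_function rho j (j f) -> is_invariant rho f.
Proof.
move=> jS Ss s0 stab fI; apply: (invariant_of_eval s0) => v sv.
have [y yj] : exists y : points U k^o, y \o j =1 eval_pt (v : 'rV[k^o]_n).
  have [_ ->] := jS k^o.
  apply: (@unit_idealP1 _ _ _ (eval_at (v : 'rV[k^o]_n) s)
    ((eval_at (v : 'rV[k^o]_n) s : k)^-1)); first by exists s.
  exact: mulVf.
pose u : points U A := (scalars A : {lrmorphism k^o -> A}) \o y.
have uj q : u (j q) = eval_at (map_mx (in_alg A) v) q.
  by rewrite eval_at_scalars -[LHS]/(((y \o j) q : k)%:A) yj.
have vu : vec j u = map_mx (in_alg A) v.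
  by apply/rowP => i; rewrite !mxE /= [LHS]uj eval_atX mxE.
have [u' u'E] := stab A u (idfun : {lrmorphism A -> A}).
have := fI A u u' (idfun : {lrmorphism A -> A}) u'E.
rewrite uj => <-.
have -> : map_mx (in_alg A) v *m rho = vec j u'.
  by rewrite u'E vu; congr (_ *m _); apply/matrixP => a b; rewrite mxE.
by rewrite -[RHS]/((u' \o j : points (affine_space k n) A) f) affine_point_eval.
Qed.

End OpenInRepresentation.

(** Spec X and the affine space share the open subscheme Spec D, where
    D = X[1 / phi t] = k[y_1, ..., y_m][1 / t], and the section is the identity of Spec D. *)
Lemma rational_retract_rational (k : fieldType) (X : comAlgType k) m
    (phi : {lrmorphism affine_space k m -> X}) (t : affine_space k m) :
  (forall q, phi q = 0 -> q = 0) -> t != 0 ->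
  (forall x, phi t * x = 0 -> x = 0) ->
  (forall x, exists e q, phi t ^+ e * x = phi q) ->
  retract_rational X.
Proof.
move=> phi_inj t0 t_reg phi_gen.
have t_nnil e : phi t ^+ e != 0.
  rewrite -lrmorphX; apply: contraNneq t0 => /phi_inj te0.
  by apply/eqP; apply: affine_space_nonnilpotent te0.
have [D [c cD]] := localization_exists t_nnil.
have [[r er] cker csurj] := cD.
exists m, D, (c \o phi : {lrmorphism affine_space k m -> D}), c.
have c_open := localization_dense_affine_open cD t_reg.
split; last by exists D, c, (idfun : {lrmorphism D -> D}).
  apply: (@localization_dense_affine_open _ _ _ _ t).
    split=> [|q /cker [e]|z]; first by exists r.
      rewrite -lrmorphX -lrmorphM => /phi_inj te; by exists e.
    have [e [x ex]] := csurj z; have [e' [q eq]] := phi_gen x.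
    exists (e' + e)%N, q; rewrite /= -eq lrmorphM lrmorphX exprD -mulrA ex.
    by [].
  by move=> a /affine_space_domain [/eqP|//]; rewrite (negPf t0).
by case: c_open.
Qed.

Theorem theorem1p2 (k : closedFieldType) (p : nat) (char_k : p \in [pchar k])
    (G : group_scheme k) (finG : finite_group_scheme G)
    (trigG : trigonalizable_group_scheme G) (BG : comAlgType k)
    (BG_model : classifying_space G BG) :
  retract_rational BG.
Proof.
have [n [rho [U [j [pi [rhoP [[S jS] j_dom] [stab _] pi_inj piE]]]]]] := BG_model.
have j_inj (a : affine_space k n) : j a = 0 -> a = 0.
  move=> ja; have [|e] := j_dom a; first by exists 1%N.
  exact: affine_space_nonnilpotent.
have j_reg := open_regular jS (@affine_space_domain k n) j_inj.
have [s Ss s0] := open_nonempty jS.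
have [h [u [h0 hI hus]]] := invariant_multiple char_k finG rhoP s0.
have inX (f : {mpoly k[n]}) : is_invariant rho f -> exists x, pi x = j f.
  by move=> fI; apply/piE/invariant_function_poly.
have [hX hXE] := inX h hI.
(* A function on BG is an invariant polynomial over a power of h. *)
have numer x : exists e (f : {mpoly k[n]}), is_invariant rho f /\ j h ^+ e * pi x = j f.
  have [e [f ef]] := open_domain_fraction jS (@affine_space_domain k n) j_inj Ss s0 (pi x).
  have ef' : j h ^+ e * pi x = j ((u : affine_space k n) ^+ e * f).
    rewrite hus [j (_ * _)]lrmorphM exprMn -mulrA ef.
    by rewrite -lrmorphX -lrmorphM.
  exists e, (u ^+ e * f); split; last exact: ef'.
  apply: (poly_invariant_function jS Ss s0 stab).
  by apply/piE; exists (hX ^+ e * x); rewrite lrmorphM lrmorphX hXE ef'.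
have [m [phi [t [phi_inj phiC phiI t0 phi_gen]]]] :=
  invariants_rational char_k finG trigG rhoP.
pose y i := sval (constructive_indefinite_description _ (inX _ (phiI 'X_i))).
have yE i : pi (y i) = j (phi 'X_i).
  exact: svalP (constructive_indefinite_description _ (inX _ (phiI 'X_i))).
pose phiX : {lrmorphism affine_space k m -> BG} := eval_pt (\row_i y i).
have phiXE q : pi (phiX q) = j (phi q).
  apply: (@mpoly_rmorph_ext m k U (pi \o phiX) (j \o phi)) => [c|i] /=.
    rewrite phiC; apply: etrans (lrmorph_mpolyC (pi \o phiX) c) _.
    by apply/esym; exact: (lrmorph_mpolyC j).
  by rewrite eval_atX mxE yE.
have [e0 [num eh]] := phi_gen h hI.
have num0 : num != 0.
  apply: contraNneq h0 => e; move/eqP: eh; rewrite e rmorph0 mulf_eq0 expf_eq0.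
  by rewrite -(rmorph0 phi) (inj_eq phi_inj) (negPf t0) andbF rmorph0.
have tnum0 : t * num != 0 by rewrite mulf_neq0.
apply: (@rational_retract_rational _ _ m phiX (t * num) _ tnum0) => [q|x|x].
- move/(congr1 pi); rewrite phiXE lrmorph0 => /j_inj.
  by rewrite -(rmorph0 phi) => /phi_inj.
- move/(congr1 pi); rewrite lrmorphM phiXE lrmorph0.
  rewrite -(lrmorph0 pi) => e; apply: pi_inj; rewrite lrmorph0 in e *.
  apply: j_reg e; rewrite -(rmorph0 phi) (inj_eq phi_inj); exact: tnum0.
have [e [f [fI ef]]] := numer x; have [e' [q eq]] := phi_gen f fI.
exists (e + e')%N, (q * t ^+ (e0 * e) * t ^+ e * num ^+ e').
apply: pi_inj; rewrite lrmorphM lrmorphX !phiXE.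
pose jphi : {rmorphism {mpoly k[m]} -> U} := j \o phi.
have enum : j (phi num) = jphi t ^+ e0 * j h by rewrite -eh lrmorphM lrmorphX.
have eqf : jphi q = jphi t ^+ e' * (j h ^+ e * pi x).
  by rewrite ef /= -eq lrmorphM lrmorphX.
rewrite -[j (phi (t * num))]/(jphi (t * num)) -[RHS]/(jphi _).
rewrite !(rmorphM jphi) !(rmorphXn jphi) eqf -[jphi num]/(j (phi num)) enum.
suff comb (R : comNzRingType) (a b z : R) : (a * (a ^+ e0 * b)) ^+ (e + e') * z =
    a ^+ e' * (b ^+ e * z) * a ^+ (e0 * e) * a ^+ e * (a ^+ e0 * b) ^+ e' by exact: comb.
rewrite !exprMn !exprD !exprM; ring.
Qed.
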